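(* Let $X$ be a metric space and $R$ a ring. If $X$ is uniformly contractible at infinity, then the inclusion of cochain complexes $CX^*(X;R)\hookrightarrow CB^*(X;R)$ induces an isomorphism on cohomology: $HX^*(X;R)\cong HB^*(X;R)$.
   Context: Uniformly contractible at infinity: there exist two non-decreasing functions $\rho,\mu:\mathbb{R}_+\to\mathbb{R}_+$ and a basepoint $b\in X$ such that any set $B\subset X$ of diameter $r$ with $d(b,B)\ge\mu(r)$ is contractible inside a set of diameter $\rho(r)$ (i.e. the inclusion of $B$ into some set of diameter at most $\rho(r)$ is null-homotopic). Cochains: $C^n(X;R)$ is the set of all functions $\phi:X^{n+1}\to R$ with $(d\phi)(x_0,\dots,x_{n+1})=\sum_{i}(-1)^i\phi(x_0,\dots,\hat{x_i},\dots,x_{n+1})$. Let $X^\infty$ be the set of eventually constant sequences in $X$ with the sup metric, and $i:X^{n+1}\to X^\infty$, $(x_0,\dots,x_n)\mapsto(x_0,\dots,x_n,x_n,\dots)$. Put $|\phi|=\{i(\sigma):\sigma\in X^{n+1},\ \phi(\sigma)\ne0\}\subset X^\infty$, let $\Delta=i(X)$ be the diagonal of $X^\infty$, and let $N_r$ denote the $r$-neighborhood. Let $\|\phi\|$ be the intersection of the diagonal $\{(x,\dots,x)\mid x\in X\}\subset X^{n+1}$ with the closure of the support of $\phi:X^{n+1}\to R$ in $X^{n+1}$. $CX^*(X;R)=\{\phi\in C^*(X;R)\mid |\phi|\cap N_r(\Delta)\text{ is bounded for all } r\}$, with cohomology $HX^*(X;R)$ (coarse cohomology). $CB^*(X;R)=\{\phi\in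 C^*(X;R)\mid \|\phi\|\text{ is bounded}\}$, with cohomology $HB^*(X;R)$ (boundedly supported cohomology). Both complexes have differential $d$, and $CX^*(X;R)\subset CB^*(X;R)$. *)

(* Defs.v *)
From HB Require Import structures.
From mathcomp Require Import all_boot all_order all_algebra.
From mathcomp Require Import generic_quotient ring_quotient zify.
From mathcomp Require Import all_classical all_reals all_analysis.

Set Implicit Arguments.
Unset Strict Implicit.
Unset Printing Implicit Defensive.

Import Order.TTheory GRing.Theory Num.Theory.
Import numFieldTopology.Exports.

Local Open Scope classical_set_scope.
Local Open Scope ring_scope.
Local Open Scope quotient_scope.

Section MetricNotions.
Context {R : realType} {X : metricType R}.
Implicit Types A B C : set X.

Definition metric_bounded A : Prop :=
  exists M : R, forall x y, A x -> A y -> mdist x y <= M.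

Definition nbhd (r : R) A : set X := [set x | exists2 a, A a & mdist a x < r].

(* The 0 only matters for the empty set, whose diameter is thus 0. *)
Definition diam A : \bar R :=
  ereal_sup (0%E |` [set (mdist xy.1 xy.2)%:E | xy in A `*` A]).

Definition set_dist (x : X) A : \bar R :=
  ereal_inf [set (mdist x a)%:E | a in A].

Definition contractible_inside B C : Prop :=
  B `<=` C /\
  exists (H : X * R -> X) (c : X),
    [/\ {within B `*` `[0, 1], continuous H},
        forall x t, B x -> 0 <= t <= 1 -> C (H (x, t)),
        forall x, B x -> H (x, 0) = x,
        forall x, B x -> H (x, 1) = c
      & C c].

Lemma metric_boundedS A B : A `<=` B -> metric_bounded B -> metric_bounded A.
Proof. by move=> AB [M BM]; exists M => x y /AB Bx /AB; exact: BM. Qed.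

Lemma metric_boundedU A B :
  metric_bounded A -> metric_bounded B -> metric_bounded (A `|` B).
Proof.
move=> bA bB.
have [->|/set0P[a Aa]] := eqVneq A set0; first by rewrite set0U.
have [->|/set0P[b Bb]] := eqVneq B set0; first by rewrite setU0.
case: bA bB => [M AM] [N BN]; exists (M + mdist a b + N).
have M0 : 0 <= M by exact: le_trans (mdist_ge0 a a) (AM _ _ Aa Aa).
have N0 : 0 <= N by exact: le_trans (mdist_ge0 b b) (BN _ _ Bb Bb).
have d0 : 0 <= mdist a b by exact: mdist_ge0.
have AB x y : A x -> B y -> mdist x y <= M + mdist a b + N.
  move=> Ax By; apply: (le_trans (metric_triangle x b y)).
  apply: lerD; last exact: BN.
  by apply: (le_trans (metric_triangle x a b)); rewrite lerD2r; exact: AM.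
move=> x y [Ax|Bx] [Ay|By].
- by apply: (le_trans (AM _ _ Ax Ay)); rewrite -addrA lerDl addr_ge0.
- exact: AB.
- by rewrite metric_sym; exact: AB.
- by apply: (le_trans (BN _ _ Bx By)); rewrite lerDr addr_ge0.
Qed.

End MetricNotions.

Definition uniformly_contractible_at_infinity
    (R : realType) (X : metricType R) : Prop :=
  exists (rho mu : {nonneg R} -> {nonneg R}) (b : X),
    [/\ {homo rho : r s / r <= s}, {homo mu : r s / r <= s}
      & forall (r : {nonneg R}) (B : set X),
          diam B = r%:num%:E -> ((mu r)%:num%:E <= set_dist b B)%E ->
          exists2 C : set X,
            (diam C <= (rho r)%:num%:E)%E & contractible_inside B C].

(* The sup metric on matrices; the library only provides its balls. *)
Section MatrixMetric.
Context {R : realType} {X : metricType R} (m n : nat).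
Implicit Types A B : 'M[X]_(m, n).

Definition mx_mdist A B : R :=
  \big[Num.max/0]_(ij : 'I_m * 'I_n) mdist (A ij.1 ij.2) (B ij.1 ij.2).

Let mx_mdist_ge0 A B : 0 <= mx_mdist A B.
Proof. exact: bigmax_ge_id. Qed.

Let mx_mdist_positivity A B : mx_mdist A B = 0 -> A = B.
Proof.
move=> AB0; apply/matrixP => i j; apply: mdist_positivity.
apply/eqP; rewrite eq_le mdist_ge0 andbT -AB0.
exact: (le_bigmax _ _ (i, j)).
Qed.

Let ballEmx_mdist A d : ball A d = [set B | mx_mdist A B < d].
Proof.
apply/seteqP; split => B /=.
  move=> [d0 AB]; apply/bigmax_ltP; split=> // -[i j] _ /=.
  by have := AB i j; rewrite ballEmdist.
move=> /bigmax_ltP[d0 AB]; split=> // i j; rewrite ballEmdist/=.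
exact: AB (i, j) isT.
Qed.

HB.instance Definition _ := @PseudoMetric_isMetric.Build R 'M[X]_(m, n)
  mx_mdist mx_mdist_ge0 mx_mdist_positivity ballEmx_mdist.

Lemma mdist_mx_le A B i j : mdist (A i j) (B i j) <= mdist A B.
Proof. exact: (le_bigmax _ _ (i, j)). Qed.

Lemma mdist_mx_leP A B e : 0 <= e ->
  (forall i j, mdist (A i j) (B i j) <= e) -> mdist A B <= e.
Proof. by move=> e0 AB; apply/bigmax_leP; split=> // -[i j] _; exact: AB. Qed.

End MatrixMetric.

Record evconst (X : Type) := EvConst {
  evconst_fun :> nat -> X;
  evconstP : exists N, forall k, (N <= k)%N -> evconst_fun k = evconst_fun N }.

HB.instance Definition _ (X : Type) := gen_eqMixin (evconst X).
HB.instance Definition _ (X : Type) := gen_choiceMixin (evconst X).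

Section EvconstMetric.
Context {R : realType} {X : metricType R}.
Implicit Types x y z : evconst X.

Definition evconst_dist x y : R := sup (range (fun k => mdist (x k) (y k))).

Lemma evconst_has_sup x y : has_sup (range (fun k => mdist (x k) (y k))).
Proof.
split; first by exists (mdist (x 0%N) (y 0%N)), 0%N.
case: (evconstP x) (evconstP y) => [N xN] [M yM].
exists (\sum_(k < (maxn N M).+1) mdist (x k) (y k)) => _ [k _ <-].
have ge0 (i : 'I_(maxn N M).+1) (_ : true) : 0 <= mdist (x i) (y i).
  exact: mdist_ge0.
have [kNM|NMk] := leqP k (maxn N M).
  rewrite (bigD1 (Ordinal (n := (maxn N M).+1) (m := k) kNM)) //=.
  by rewrite lerDl sumr_ge0 // => i _; exact: ge0.
have [Nk Mk] : (N <= k /\ M <= k)%N.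
  by move: (ltnW NMk); rewrite geq_max => /andP[].
have -> : mdist (x k) (y k) = mdist (x (maxn N M)) (y (maxn N M)).
  by rewrite (xN _ Nk) (yM _ Mk) (xN _ (leq_maxl _ _)) (yM _ (leq_maxr _ _)).
rewrite (bigD1 ord_max) //= lerDl sumr_ge0 // => i _; exact: ge0.
Qed.

Lemma evconst_dist_ge x y k : mdist (x k) (y k) <= evconst_dist x y.
Proof. by apply: ub_le_sup; [case: (evconst_has_sup x y) | exists k]. Qed.

Lemma evconst_dist_le x y e :
  (forall k, mdist (x k) (y k) <= e) -> evconst_dist x y <= e.
Proof.
by move=> xye; apply: ge_sup => [|_ [k _ <-]//]; case: (evconst_has_sup x y).
Qed.

Let evconst_distxx x : evconst_dist x x = 0.
Proof.
apply/eqP; rewrite eq_le; apply/andP; split.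
  by apply: evconst_dist_le => k; rewrite mdistxx.
exact: le_trans (mdist_ge0 _ _) (evconst_dist_ge x x 0%N).
Qed.

Let evconst_dist_positivity x y : evconst_dist x y = 0 -> x = y.
Proof.
move=> xy0; have : evconst_fun x = evconst_fun y.
  apply/funext => k; apply: mdist_positivity; apply/eqP.
  by rewrite eq_le mdist_ge0 andbT -xy0 evconst_dist_ge.
case: x y {xy0} => [x hx] [y hy] /= xy; case: y / xy hy => hy.
by congr EvConst; exact: Prop_irrelevance.
Qed.

Let evconst_dist_sym x y : evconst_dist x y = evconst_dist y x.
Proof.
have E : (fun k => mdist (x k) (y k)) = (fun k => mdist (y k) (x k)).
  by apply/funext => k; rewrite metric_sym.
by rewrite /evconst_dist E.
Qed.

Let evconst_dist_triangle y x z :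
  evconst_dist x z <= evconst_dist x y + evconst_dist y z.
Proof.
apply: evconst_dist_le => k; apply: (le_trans (metric_triangle _ (y k) _)).
by apply: lerD; exact: evconst_dist_ge.
Qed.

HB.instance Definition _ := @isMetric.Build R (evconst X) evconst_dist
  evconst_distxx evconst_dist_positivity evconst_dist_sym
  evconst_dist_triangle.

End EvconstMetric.

(* (x_0, ..., x_n) |-> (x_0, ..., x_n, x_n, ...) *)
Section Stabilize.
Variables (X : Type) (n : nat) (s : 'rV[X]_n.+1).

Definition stabilize_fun (k : nat) : X := s 0 (inord (minn k n)).

Lemma stabilize_evconst :
  exists N, forall k, (N <= k)%N -> stabilize_fun k = stabilize_fun N.
Proof.
by exists n => k nk; rewrite /stabilize_fun minnn (minn_idPr nk).
Qed.

Definition stabilize : evconst X := EvConst stabilize_evconst.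

End Stabilize.

Definition diagonal_inf (X : Type) : set (evconst X) :=
  range (fun x : X => stabilize (const_mx x : 'rV[X]_1)).
Arguments diagonal_inf : clear implicits.

Section Cochains.
Variables (X : Type) (K : pzRingType).

(* 'rV[X]_n.+1 is X^{n+1}; K^o is K as a left module over itself. *)
Definition cochain (n : nat) : Type := 'rV[X]_n.+1 -> K^o.

HB.instance Definition _ n := GRing.Lmodule.on (cochain n).

(* col' i deletes the i-th entry *)
Definition cochain_diff n (phi : cochain n) : cochain n.+1 :=
  fun s => \sum_(i < n.+2) (-1) ^+ i * phi (col' i s).

Lemma cochain_diff_linear n : linear (@cochain_diff n).
Proof.
move=> a phi psi; apply/funext => s.
have -> : (a *: cochain_diff phi + cochain_diff psi) s =
  a * cochain_diff phi s + cochain_diff psi s by [].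
rewrite /cochain_diff mulr_sumr -big_split /=; apply: eq_bigr => i _.
have -> : (a *: phi + psi) (col' i s) = a * phi (col' i s) + psi (col' i s).
  by [].
by rewrite mulrDr !mulrA commr_sign.
Qed.

HB.instance Definition _ n := GRing.isLinear.Build K (cochain n) (cochain n.+1)
  _ (@cochain_diff n) (@cochain_diff_linear n).

Lemma cochain_diffK n (phi : cochain n) :
  cochain_diff (cochain_diff phi) = 0.
Proof.
apply/funext => s; rewrite /cochain_diff.
under eq_bigr do rewrite mulr_sumr.
rewrite pair_bigA /= (bigID (fun p : 'I_n.+3 * 'I_n.+2 => (p.2 < p.1)%N)) /=.
rewrite addrC (reindex_onto (fun p : 'I_n.+3 * 'I_n.+2 =>
    (inord p.2, inord p.1.-1)) (fun p => (inord p.2.+1, inord p.1))) /=; last first.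
  move=> [i j] /=; rewrite -leqNgt => ij; congr (_, _); apply/val_inj => /=.
    by rewrite !inordK //; move: (ltn_ord j); lia.
  by rewrite !inordK //; move: (ltn_ord j); lia.
rewrite (eq_bigl (fun p : 'I_n.+3 * 'I_n.+2 => (p.2 < p.1)%N)); last first.
  move=> [i j] /=; move: (ltn_ord i) (ltn_ord j) => hi hj.
  have e1 : (inord j : 'I_n.+3) = j :> nat by rewrite inordK //; lia.
  have e2 : (inord i.-1 : 'I_n.+2) = i.-1 :> nat by rewrite inordK //; lia.
  rewrite -leqNgt e1 e2; apply/andP/idP => [[ji /eqP[/(congr1 val)/= Ei _]]|ji].
    have : (i.-1.+1 = i)%N by rewrite -[RHS]Ei inordK //; lia.
    lia.
  split; first by lia.
  by rewrite xpair_eqE; apply/andP; split; apply/eqP/val_inj; rewrite /= inordK; lia.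
rewrite -big_split /= big1 // => -[i j] /= ji.
move: (ltn_ord i) (ltn_ord j) => hi hj.
have e1 : (inord j : 'I_n.+3) = j :> nat by rewrite inordK //; lia.
have e2 : (inord i.-1 : 'I_n.+2) = i.-1 :> nat by rewrite inordK //; lia.
have -> : col' (inord i.-1) (col' (inord j) s) = col' j (col' i s).
  apply/matrixP => a k; rewrite !mxE; congr (s _ _); apply/val_inj => /=.
  rewrite e1 e2 /bump; lia.
rewrite !mulrA -!exprD e1 e2 -mulrDl.
have -> : (i + j)%N = (j + i.-1).+1 by lia.
by rewrite exprS mulN1r addrN mul0r.
Qed.

End Cochains.


(* The library quotients modules only as abelian groups; scaling is added. *)
Section QuotientModule.
Variables (K : pzRingType) (V : lmodType K) (I : submodClosed V).

Definition submod_pred : {pred V} := fun v => v \in I.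

HB.instance Definition _ :=
  GRing.isSubmodClosed.Build K V submod_pred (GRing.subsemimodClosedP I).

Definition lquot : Type := Quotient.quot submod_pred.

HB.instance Definition _ := GRing.Zmodule.on lquot.

Definition lquot_pi (v : V) : lquot := \pi_(Quotient.quot submod_pred) v.

Lemma lquot_piP u v : lquot_pi u = lquot_pi v <-> u - v \in I.
Proof.
rewrite -[u - v \in I]/(u - v \in submod_pred) Quotient.idealrBE.
by split => [uv|/eqP//]; apply/eqP.
Qed.

Lemma lquot_piD : {morph lquot_pi : u v / u + v}.
Proof. by move=> u v; rewrite /lquot_pi [LHS]pi_addr. Qed.

Lemma lquot_pi_surj (q : lquot) : exists v, q = lquot_pi v.
Proof. by exists (repr (q : Quotient.quot submod_pred)); rewrite /lquot_pi reprK. Qed.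

Definition lquot_scale (a : K) (q : lquot) : lquot :=
  lquot_pi (a *: repr (q : Quotient.quot submod_pred)).

Lemma lquot_piZ a v : lquot_scale a (lquot_pi v) = lquot_pi (a *: v).
Proof.
apply/lquot_piP; rewrite -scalerBr; apply: rpredZ; apply/lquot_piP.
by rewrite /lquot_pi reprK.
Qed.

Let scaleA a b q : lquot_scale a (lquot_scale b q) = lquot_scale (a * b) q.
Proof. by have [v ->] := lquot_pi_surj q; rewrite !lquot_piZ scalerA. Qed.

Let scale1 : left_id 1 lquot_scale.
Proof. by move=> q; have [v ->] := lquot_pi_surj q; rewrite !lquot_piZ scale1r. Qed.

Let scaleDr : right_distributive lquot_scale +%R.
Proof.
move=> a p q; have [u ->] := lquot_pi_surj p; have [v ->] := lquot_pi_surj q.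
by rewrite -lquot_piD !lquot_piZ scalerDr lquot_piD.
Qed.

Let scaleDl q : {morph lquot_scale^~ q : a b / a + b}.
Proof.
move=> a b; have [v ->] := lquot_pi_surj q.
by rewrite !lquot_piZ scalerDl lquot_piD.
Qed.

HB.instance Definition _ := GRing.Zmodule_isLmodule.Build K lquot
  scaleA scale1 scaleDr scaleDl.

Lemma lquot_pi_linear : linear lquot_pi.
Proof. by move=> a u v; rewrite lquot_piD -lquot_piZ. Qed.

HB.instance Definition _ := GRing.isLinear.Build K V lquot _ lquot_pi
  lquot_pi_linear.

End QuotientModule.

Section Cohomology.
Variables (X : Type) (K : pzRingType).
Variable S : forall n, submodClosed (cochain X K n).

Definition is_cocycle n : {pred cochain X K n} :=
  fun phi => (phi \in S n) && (cochain_diff phi == 0).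

Lemma is_cocycle_submod n : subsemimod_closed (@is_cocycle n).
Proof.
split; first split.
- by apply/andP; rewrite rpred0 linear0.
- move=> phi psi /andP[Sphi /eqP dphi] /andP[Spsi /eqP dpsi]; apply/andP.
  by rewrite rpredD // linearD /= dphi dpsi addr0.
- move=> a phi /andP[Sphi /eqP dphi]; apply/andP.
  by rewrite rpredZ // linearZ /= dphi scaler0.
Qed.

HB.instance Definition _ n := GRing.isSubmodClosed.Build K (cochain X K n)
  (@is_cocycle n) (@is_cocycle_submod n).

Record cocycle n := Cocycle {
  cocycle_val :> cochain X K n;
  cocycleP : cocycle_val \in @is_cocycle n }.

HB.instance Definition _ n := [isSub for @cocycle_val n].
HB.instance Definition _ n := [Choice of cocycle n by <:].
HB.instance Definition _ n := [SubChoice_isSubLmodule of cocycle n by <:].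

(* There are no cochains in degree -1, hence no nonzero coboundary in degree
   0 (the complex is not augmented). *)
Definition coboundary_of n : cochain X K n -> Prop :=
  match n with
  | 0%N => fun phi => phi = 0
  | m.+1 => fun phi => exists2 psi : cochain X K m,
              psi \in S m & cochain_diff psi = phi
  end.

Definition is_coboundary n : {pred cocycle n} :=
  fun z => `[< coboundary_of (cocycle_val z) >].

Lemma is_coboundary_submod n : subsemimod_closed (@is_coboundary n).
Proof.
case: n => [|n]; (split; first split).
- exact/asboolP.
- move=> x y /asboolP/= x0 /asboolP/= y0; apply/asboolP => /=.
  by rewrite x0 y0 addr0.
- by move=> a x /asboolP/= x0; apply/asboolP; rewrite /= x0 scaler0.
- by apply/asboolP; exists 0; rewrite ?rpred0 ?linear0.
- move=> x y /asboolP[u Su ux] /asboolP[v Sv vy]; apply/asboolP.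
  by exists (u + v); rewrite ?rpredD // linearD /= ux vy.
- move=> a x /asboolP[u Su ux]; apply/asboolP.
  by exists (a *: u); rewrite ?rpredZ // linearZ /= ux.
Qed.

HB.instance Definition _ n := GRing.isSubmodClosed.Build K (cocycle n)
  (@is_coboundary n) (@is_coboundary_submod n).

Definition cohomology n : lmodType K := lquot (@is_coboundary n).

Definition cohomology_class n (z : cocycle n) : cohomology n := lquot_pi _ z.

End Cohomology.

Section CoarseAndBounded.
Context {R : realType} (X : metricType R) (K : pzRingType).

Definition support_inf n (phi : cochain X K n) : set (evconst X) :=
  [set stabilize s | s in [set s | phi s != 0]].

Definition diagonal_support n (phi : cochain X K n) : set 'rV[X]_n.+1 :=
  range const_mx `&` closure [set s | phi s != 0].

Definition CX n : {pred cochain X K n} := fun phi =>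
  `[< forall r : R,
      metric_bounded (support_inf phi `&` nbhd r (diagonal_inf X)) >].

Definition CB n : {pred cochain X K n} := fun phi =>
  `[< metric_bounded (diagonal_support phi) >].

Lemma support_sub n a (phi psi : cochain X K n) :
  [set s | (a *: phi + psi) s != 0] `<=`
  [set s | phi s != 0] `|` [set s | psi s != 0].
Proof.
move=> s /=; have [phi0|] := eqVneq (phi s) 0; last by left.
have [psi0|] := eqVneq (psi s) 0; last by right.
have -> : (a *: phi + psi) s = a *: phi s + psi s by [].
by rewrite phi0 psi0 scaler0 addr0 eqxx.
Qed.

Lemma CX_submod n : submod_closed (@CX n).
Proof.
split.
  apply/asboolP => r; apply: (@metric_boundedS _ _ _ set0).
    by move=> t [[s /=]]; rewrite eqxx.
  by exists 0.
move=> a phi psi /asboolP bphi /asboolP bpsi; apply/asboolP => r.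
apply: metric_boundedS (metric_boundedU (bphi r) (bpsi r)).
move=> _ [[s /support_sub phipsi <-] sr].
by case: phipsi => ss; [left|right]; split => //; exists s.
Qed.

Lemma CB_submod n : submod_closed (@CB n).
Proof.
split.
  apply/asboolP; apply: (@metric_boundedS _ _ _ set0).
    move=> s [_]; have -> : [set s | (0 : cochain X K n) s != 0] = set0.
      by apply/seteqP; split => [t /=|t []]; rewrite eqxx.
    by rewrite closure0.
  by exists 0.
move=> a phi psi /asboolP bphi /asboolP bpsi; apply/asboolP.
apply: metric_boundedS (metric_boundedU bphi bpsi).
move=> s [ds /(closure_subset (@support_sub n a phi psi))].
by rewrite closureU => -[?|?]; [left|right].
Qed.

HB.instance Definition _ n := GRing.isSubmodClosed.Build K (cochain X K n)
  (@CX n) (GRing.submod_closed_semi (@CX_submod n)).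
HB.instance Definition _ n := GRing.isSubmodClosed.Build K (cochain X K n)
  (@CB n) (GRing.submod_closed_semi (@CB_submod n)).

Lemma CX_sub_CB n : {subset @CX n <= @CB n}.
Proof.
move=> phi /asboolP /(_ 1) [M bM]; apply/asboolP.
exists (1 + M + 1) => _ _ [[x _ <-] clx] [[y _ <-] cly].
have near1 z : closure [set s | phi s != 0] (const_mx z) ->
    exists s : 'rV[X]_n.+1, [/\ (support_inf phi `&` nbhd 1 (diagonal_inf X)) (stabilize s)
      & mdist (const_mx z) s <= 1].
  move=> clz; have e0 : 0 < 2^-1 :> R by rewrite invr_gt0.
  have [s [/= s0]] := clz _ (nbhsx_ballx _ _ e0).
  rewrite ballEmdist /= => zs; exists s; split; last first.
    by rewrite (le_trans (ltW zs)) // invf_le1 // ler1n.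
  split; first by exists s.
  exists (stabilize (const_mx z : 'rV_1)); first by exists z.
  apply: (@le_lt_trans _ _ 2^-1); last by rewrite invf_lt1 // ltr1n.
  apply: evconst_dist_le => k; rewrite /= /stabilize_fun mxE.
  apply: le_trans (ltW zs).
  by have := mdist_mx_le (const_mx z) s 0 (inord (minn k n)); rewrite mxE.
have [s [sb xs]] := near1 _ clx; have [t [tb yt]] := near1 _ cly.
apply: (le_trans (metric_triangle _ t _)); apply: lerD; last first.
  by rewrite metric_sym.
apply: (le_trans (metric_triangle _ s _)); apply: lerD => //.
apply: (le_trans _ (bM _ _ sb tb)).
apply: mdist_mx_leP => [|i j]; first exact: mdist_ge0.
have := evconst_dist_ge (stabilize s) (stabilize t) j.
by rewrite /= /stabilize_fun (ord1 i) (minn_idPl _) ?inord_val // -ltnS.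
Qed.

Lemma CX_diff n (phi : cochain X K n) :
  phi \in @CX n -> cochain_diff phi \in @CX n.+1.
Proof.
move=> /asboolP bphi; apply/asboolP => r; have [M bM] := bphi r.
have face s : (support_inf (cochain_diff phi) `&` nbhd r (diagonal_inf X)) s ->
   exists t : evconst X,
     (support_inf phi `&` nbhd r (diagonal_inf X)) t /\ mdist s t <= r + r.
  move=> [[u /= du <-] [_ [x _ <-] xu]].
  have [i ui] : exists i, phi (col' i u) != 0.
    apply/existsP; apply: contra_neqT du; rewrite negb_exists => /forallP u0.
    by rewrite /cochain_diff big1 // => i _; have /negPn/eqP -> := u0 i; rewrite mulr0.
  have xuk k : mdist x (u 0 k) <= evconst_dist (stabilize (const_mx x : 'rV_1)) (stabilize u).
    have := evconst_dist_ge (stabilize (const_mx x : 'rV_1)) (stabilize u) k.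
    by rewrite /= /stabilize_fun mxE (minn_idPl _) ?inord_val // -ltnS.
  have xc : mdist (stabilize (const_mx x : 'rV_1)) (stabilize (col' i u)) < r.
    apply: le_lt_trans xu; apply: evconst_dist_le => k.
    by rewrite /= /stabilize_fun !mxE; exact: xuk.
  exists (stabilize (col' i u)); split.
    split; first by exists (col' i u).
    by exists (stabilize (const_mx x : 'rV_1)) => //; exists x.
  apply: (le_trans (metric_triangle _ (stabilize (const_mx x : 'rV_1)) _)).
  by rewrite metric_sym; apply: lerD; apply: ltW.
exists ((r + r) + M + (r + r)) => s t /face[s' [s'b ss']] /face[t' [t'b tt']].
apply: (le_trans (metric_triangle _ t' _)); apply: lerD; last by rewrite metric_sym.
apply: (le_trans (metric_triangle _ s' _)); apply: lerD => //; exact: bM.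
Qed.

Lemma CB_diff n (phi : cochain X K n) :
  phi \in @CB n -> cochain_diff phi \in @CB n.+1.
Proof.
move=> /asboolP[M bM]; apply/asboolP.
have face x : closure [set s | cochain_diff phi s != 0] (const_mx x) ->
   closure [set s | phi s != 0] (const_mx x).
  move=> clx U /nbhs_ballP[e /= e0 eU].
  have [u [/= du]] := clx _ (nbhsx_ballx _ _ e0).
  move=> [_ xu].
  have [i ui] : exists i, phi (col' i u) != 0.
    apply/existsP; apply: contra_neqT du; rewrite negb_exists => /forallP u0.
    by rewrite /cochain_diff big1 // => i _; have /negPn/eqP -> := u0 i; rewrite mulr0.
  exists (col' i u); split=> //; apply: eU; split => // a b.
  by have := xu a (lift i b); rewrite !mxE.
exists M => _ _ [[x _ <-] /face cx] [[y _ <-] /face cy].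
have := bM _ _ (conj (ex_intro2 _ _ x I erefl) cx) (conj (ex_intro2 _ _ y I erefl) cy).
move=> h; apply: mdist_mx_leP => [|i j]; first exact: le_trans (mdist_ge0 _ _) h.
rewrite !mxE; apply: le_trans h.
by have := mdist_mx_le (const_mx x : 'rV[X]_n.+1) (const_mx y) 0 0; rewrite !mxE.
Qed.

Definition coarse_complex n : submodClosed (cochain X K n) := @CX n.
Definition bounded_complex n : submodClosed (cochain X K n) := @CB n.

Definition coarse_cohomology n : lmodType K := cohomology coarse_complex n.
Definition bounded_cohomology n : lmodType K := cohomology bounded_complex n.

Lemma cocycle_incl_subproof n (z : cocycle coarse_complex n) :
  cocycle_val z \in @is_cocycle _ _ bounded_complex n.
Proof.
by case: z => phi /= /andP[/CX_sub_CB Bphi dphi]; apply/andP.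
Qed.

Definition cocycle_incl n (z : cocycle coarse_complex n) :
  cocycle bounded_complex n := Cocycle (cocycle_incl_subproof z).

End CoarseAndBounded.

(* Main.v *)
(* CB/CX is acyclic.  Call a function f(x; y) of two tuples vanishing when,
   for every r, it is zero for y in a neighbourhood (depending on x) of each
   diagonal point that lies within r of x and far from the basepoint; functions
   modulo vanishing ones form a double complex.  For fixed x it computes the
   Alexander-Spanier cohomology of large balls around x, so its rows are exact
   because a null-homotopic inclusion kills cohomology.  The functions
   constant in y modulo vanishing ones form C/CX, and those constant in x form
   C/CB.  To return from the double complex to C/CB one evaluates x at pi(y),
   where pi moves points by a bounded amount and has a locally finite image:
   then only finitely many of the neighbourhoods depending on x are
   intersected. *)

Require Import Defs.
From HB Require Import structures.
From mathcomp Require Import all_boot all_order all_algebra.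
From mathcomp Require Import lra zify.
From mathcomp Require Import all_classical all_reals all_analysis.

Set Implicit Arguments.
Unset Strict Implicit.
Unset Printing Implicit Defensive.

Import Order.TTheory GRing.Theory Num.Theory.
Import numFieldTopology.Exports.

Local Open Scope classical_set_scope.
Local Open Scope ring_scope.

(** * Cochains on lists *)

Section ListCochains.
Variables (X : Type) (K : pzRingType).
Implicit Types (phi psi : seq X -> K) (s t x y : seq X).

(** The alternating sum over deletions, by recursion on the first entry. Lists of all lengths share
    one type, so tuples are split and joined without casts. The empty list has degree -1: on
    one-entry lists [bd] is the augmentation, which matters where the double complex ends. *)
Fixpoint bd phi s : K :=
  if s is a :: s' then phi s' - bd (fun t => phi (a :: t)) s' else 0.

Lemma eq_bd (P : pred X) phi psi s :
  (forall t, size t = (size s).-1 -> all P t -> phi t = psi t) ->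
  all P s -> bd phi s = bd psi s.
Proof.
elim: s phi psi => //= a s IH phi psi E /andP[Pa Ps]; congr (_ - _).
  by apply: E.
case: s IH E Ps => [|c s] IH E Ps; first by [].
apply: IH => // t ts Pt.
by apply: E; rewrite /= ?ts ?Pa.
Qed.

Lemma eq_bdT phi psi s :
  (forall t, size t = (size s).-1 -> phi t = psi t) -> bd phi s = bd psi s.
Proof.
by move=> E; apply: (@eq_bd predT) => [t ts _|]; rewrite ?all_predT //; exact: E.
Qed.

Lemma bd0 s : bd (fun=> 0) s = 0.
Proof. by elim: s => //= a s ->; rewrite subrr. Qed.

Lemma bdD phi psi s : bd (fun t => phi t + psi t) s = bd phi s + bd psi s.
Proof.
elim: s phi psi => [|a s IH] phi psi /=; first by rewrite addr0.
by rewrite IH opprD addrACA.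
Qed.

Lemma bdZ c phi s : bd (fun t => c * phi t) s = c * bd phi s.
Proof. by elim: s phi => [|a s IH] phi /=; rewrite ?mulr0 // IH mulrBr. Qed.

Lemma bdN phi s : bd (fun t => - phi t) s = - bd phi s.
Proof. by elim: s phi => [|a s IH] phi /=; rewrite ?oppr0 // IH opprD. Qed.

Lemma bdB phi psi s : bd (fun t => phi t - psi t) s = bd phi s - bd psi s.
Proof. by rewrite bdD bdN. Qed.

Lemma bd_sum n (F : nat -> seq X -> K) s :
  bd (fun t => \sum_(j < n) F j t) s = \sum_(j < n) bd (F j) s.
Proof.
elim: n F => [|n IH] F.
  by rewrite big_ord0 -[RHS](bd0 s); congr bd; apply/funext => t; rewrite big_ord0.
rewrite big_ord_recr /= -IH -bdD; congr bd.
by apply/funext => t; rewrite big_ord_recr.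
Qed.

Lemma bd_bd phi s : bd (bd phi) s = 0.
Proof.
elim: s phi => //= a s IH phi.
by rewrite bdB IH subr0 subrr.
Qed.

Lemma bd_const k s : bd (fun=> k) s = if odd (size s) then k else 0.
Proof. by elim: s => //= a s ->; case: odd; rewrite /= ?subrr ?subr0. Qed.

(** Splits the differential of [phi] into the two differentials of the double complex. *)
Lemma bd_cat phi x y : bd phi (x ++ y) =
  bd (fun x' => phi (x' ++ y)) x + (-1) ^+ size x * bd (fun y' => phi (x ++ y')) y.
Proof.
elim: x phi => [|a x IH] phi /=; first by rewrite add0r expr0 mul1r.
by rewrite IH opprD addrA exprS mulN1r mulNr.
Qed.

Lemma bd_exchange (f : seq X -> seq X -> K) x y :
  bd (fun x' => bd (f x') y) x = bd (fun y' => bd (fun x' => f x' y') x) y.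
Proof. by elim: x f => [|a x IH] f /=; rewrite ?bd0 // IH bdB. Qed.

Lemma bd_map (g : X -> X) phi s : bd (fun t => phi (map g t)) s = bd phi (map g s).
Proof. by elim: s phi => //= a s IH phi; rewrite -IH. Qed.

Section Prism.
Variables g g' : X -> X.

(** The prism operator: the alternating sum over [i] of the values of [phi] at
    [g a_0, ..., g a_i, g' a_i, ..., g' a_n]. *)
Fixpoint prism phi s : K :=
  if s is a :: s' then
    phi (g a :: g' a :: map g' s') - prism (fun t => phi (g a :: t)) s'
  else 0.

Lemma prismB phi psi s :
  prism (fun t => phi t - psi t) s = prism phi s - prism psi s.
Proof.
elim: s phi psi => [|a s IH] phi psi /=; first by rewrite subr0.
by rewrite IH !opprD addrACA.
Qed.

(** The prism operator is a cochain homotopy between the pullbacks along [g] and [g']. *)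
Lemma bd_prism phi s :
  bd (prism phi) s = phi (map g' s) - phi (map g s) - prism (bd phi) s.
Proof.
elim: s phi => [|a s IH] phi /=; first by rewrite !subrr.
rewrite bdB prismB IH (bd_map g' (fun t => phi (g a :: g' a :: t))) !opprB !addrA.
by rewrite [RHS](ACl (3*5*2*4*6*(1*7))%AC) /= subrr addr0.
Qed.

Lemma prism_eq0 (P : pred X) phi s :
  (forall t, size t = (size s).+1 -> all P t -> phi t = 0) ->
  all (fun z => P (g z) && P (g' z)) s -> prism phi s = 0.
Proof.
elim: s phi => //= a s IH phi phi0 /andP[/andP[Pa P'a] Ps].
rewrite phi0 ?IH ?subrr //=; last 2 first.
- by rewrite size_map.
- rewrite Pa P'a all_map; apply: sub_all Ps => z /andP[_ //].
by move=> t ts Pt; apply: phi0; rewrite /= ?ts ?Pa.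
Qed.

End Prism.

(* The Alexander-Whitney formula, with the front face moved by [pi]. *)
Definition front_back (pi : X -> X) p (w : seq X -> seq X -> K) s : K :=
  w (map pi (take p.+1 s)) (drop p s).

(** Deleting the last front entry in the first term and the first back entry in the second both give
    [w (map pi (take p.+1 s)) (drop p.+1 s)], with opposite signs; the other deletions match. *)
Lemma bd_front_back pi p w s : (p.+2 <= size s)%N ->
  bd (front_back pi p w) s =
  front_back pi p.+1 (fun x y => bd (fun x' => w x' y) x) s +
  (-1) ^+ p * front_back pi p (fun x y => bd (w x) y) s.
Proof.
elim: p w s => [|p IH] w [|a s] //.
  case: s => // c s _; rewrite /front_back /= !take0 /= expr0 mul1r.
  by rewrite subr0 addrA subrK.
rewrite ltnS => ps.
have -> : bd (front_back pi p.+1 w) (a :: s) = front_back pi p.+1 w s -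
   bd (front_back pi p (fun x => w (pi a :: x))) s by [].
rewrite IH // opprD addrA exprS mulN1r mulNr; congr (_ - _).
Qed.

End ListCochains.

(** * A locally finite map close to the identity *)

Section LocallyFiniteMap.
Context {R : realType} {X : metricType R}.
Implicit Types (x y z : X).

(* M. E. Rudin's proof that metric spaces are paracompact, run on the cover by
   unit balls: with [m z] the first centre (for a well-ordering) of a unit ball
   containing [z], points [z] well inside the ball around [m z] and with
   distinct [m z] are far apart. *)
Lemma locally_finite_map : exists pi : X -> X,
  (forall y, mdist y (pi y) < 2) /\
  (forall y, exists2 e : R, 0 < e &
     exists L : seq X, forall z, mdist y z < e -> pi z \in L).
Proof.
have [W wo] := wochoice.well_ordering_principle X.
have W_anti x y : W x y -> W y x -> x = y.
  move=> Wxy Wyx; apply: (wochoice.wo_chain_antisymmetric (C := predT)) => //.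
    by move=> A _; exact: wo.
  by rewrite Wxy.
have /choice[m m_min] : forall y, exists a,
    mdist y a < 1 /\ forall a', mdist y a' < 1 -> W a a'.
  move=> y; have [|a [[ya amin] _]] := wo [pred a | mdist y a < 1].
    by exists y; rewrite inE mdistxx.
  by exists a; split=> // a' ya'; exact: amin.
pose c (n : nat) : R := n.+1%:R^-1.
have c0 n : 0 < c n by rewrite invr_gt0.
(* Here [z] has depth at least [3 * c n] in the unit ball around [m z]. Two such points less than
   [3 * c n] apart lie in each other's ball, so minimality gives them the same centre. *)
pose close n y z := 3 * c n <= 1 - mdist z (m z) /\ mdist y z < c n.
have close_eq n y z y' z' : close n y z -> close n y' z' ->
    mdist y y' < c n -> m z = m z'.
  move=> [gz yz] [gz' yz'] yy'.
  have zz' : mdist z z' < 3 * c n.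
    have := metric_triangle z y z'; have := metric_triangle y y' z'.
    by rewrite (metric_sym z y); lra.
  apply: W_anti; [have [_] := m_min z | have [_] := m_min z'].
    by apply; have := metric_triangle z z' (m z'); lra.
  apply; have := metric_triangle z' z (m z); rewrite (metric_sym z' z); lra.
have /choice[zn zn_min] : forall y, exists zn : X * nat,
    close zn.2 y zn.1 /\ forall k z, close k y z -> (zn.2 <= k)%N.
  move=> y.
  have : exists n, `[< exists z, close n y z >].
    have d0 : 0 < (1 - mdist y (m y)) / 3.
      by rewrite divr_gt0 // subr_gt0; case: (m_min y).
    exists (Num.truncn ((1 - mdist y (m y)) / 3)^-1); apply/asboolP; exists y.
    split; last by rewrite mdistxx.
    rewrite mulrC -ler_pdivlMr // /c invf_ple ?posrE //.
    by apply: ltW; apply: truncnS_gt.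
  move=> /ex_minnP[n /asboolP[z nyz] nmin]; exists (z, n); split=> // k z' kyz'.
  by apply: nmin; apply/asboolP; exists z'.
exists (fun y => m (zn y).1); split=> y.
  have [[gz yz] _] := zn_min y; have [zm _] := m_min (zn y).1.
  have c1 : c (zn y).2 <= 1 by rewrite invf_le1 // ler1n.
  by have := metric_triangle y (zn y).1 (m (zn y).1); lra.
have [[gz yz] _] := zn_min y; set n := (zn y).2 in gz yz.
(* The first bound keeps [(zn y).1] close to all points of the [e]-ball, so their levels are at most
   [n]. The second makes any two of them less than [c i] apart for all [i <= n], so each level
   contributes one centre. *)
pose e : R := Num.min (c n - mdist y (zn y).1) (c n / 2).
have e0 : 0 < e by rewrite lt_min subr_gt0 yz divr_gt0.
have ec : e <= c n / 2 by rewrite ge_min lexx orbT.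
exists e => //.
have /choice[a a_val] : forall i, exists a, forall p z,
    (i <= n)%N -> mdist y p < e -> close i p z -> m z = a.
  move=> i.
  have [[p [z [le_in yp ipz]]]|] :=
    pselect (exists p z, [/\ (i <= n)%N, mdist y p < e & close i p z]).
    exists (m z) => p' z' _ yp' ip'z'; apply: close_eq ip'z' ipz _.
    have : c n <= c i by rewrite lef_pV2 ?posrE // ler_nat.
    by have := metric_triangle p' y p; rewrite (metric_sym p' y); lra.
  (* No point near [y] has level [i]; [y] is a dummy centre. *)
  by move=> none; exists y => p z *; case: none; exists p, z.
exists [seq a i | i <- iota 0 n.+1] => z yz'.
have [czz zmin] := zn_min z.
have le_n : ((zn z).2 <= n)%N.
  apply: (zmin _ (zn y).1); split=> //.
  have : e <= c n - mdist y (zn y).1 by rewrite ge_min lexx.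
  by have := metric_triangle z y (zn y).1; rewrite (metric_sym z y); lra.
by apply/mapP; exists (zn z).2; [rewrite mem_iota | exact: a_val le_n yz' czz].
Qed.

End LocallyFiniteMap.

(** * Null-homotopic inclusions *)

Section NullHomotopicInclusion.
Context {R : realType} {X : metricType R} (K : pzRingType).
Variables (B C : set X) (H : X * R -> X) (c : X).
Hypothesis H_continuous : {within B `*` `[0, 1], continuous H}.
Hypothesis H_C : forall x t, B x -> 0 <= t <= 1 -> C (H (x, t)).
Hypothesis H0 : forall x, B x -> H (x, 0) = x.
Hypothesis H1 : forall x, B x -> H (x, 1) = c.
Variables (f : seq X -> K) (q : nat).
Hypothesis f_cocycle : forall y, C y -> exists2 e : R, 0 < e &
  forall s, size s = q.+2 -> all (fun z => mdist y z < e) s -> bd f s = 0.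

Let tube (y : X) (t d : R) : set X := [set p | exists z t',
  [/\ B z, mdist y z < d, 0 <= t' <= 1, `|t - t'| < d & p = H (z, t')]].

Let cocycle_on_tube (y : X) (t d : R) :=
  forall s, size s = q.+2 -> all (mem (tube y t d)) s -> bd f s = 0.

Let tubeS (y : X) (t d : R) (y' : X) (t' d' : R) :
  mdist y' y + d <= d' -> `|t' - t| + d <= d' ->
  tube y t d `<=` tube y' t' d'.
Proof.
move=> yd td p [z [u [Bz yz u01 tu ->]]]; exists z, u; split=> //.
  by apply: le_lt_trans (metric_triangle _ y _) _; lra.
by apply: le_lt_trans (ler_distD t _ _) _; lra.
Qed.

Let cocycle_on_tubeS (y : X) (t d : R) (y' : X) (t' d' : R) :
  mdist y' y + d <= d' -> `|t' - t| + d <= d' ->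
  cocycle_on_tube y' t' d' -> cocycle_on_tube y t d.
Proof.
move=> yd td coc s sz /allP Ps; apply: coc => //; apply/allP => p /Ps.
by rewrite !inE; exact: tubeS.
Qed.

Let cocycle_on_small_tube (y : X) (t : R) : B y -> 0 <= t <= 1 ->
  exists2 d : R, 0 < d & cocycle_on_tube y t d.
Proof.
move=> By t01; have [e e0 coc] := f_cocycle (H_C By t01).
have Hyt : H @ within (B `*` `[0, 1]) (nbhs (y, t)) --> H (y, t).
  by move/subspace_continuousP : H_continuous; apply; split=> //=; rewrite in_itv.
have /Hyt : nbhs (H (y, t)) (ball (H (y, t)) e) by exact: nbhsx_ballx.
rewrite /nbhs /= /within /= => -[[U V] [/= /nbhs_ballP[d1 /= d10 U1]]].
move=> /nbhs_ballP[d2 /= d20 V2] UV.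
exists (Num.min d1 d2); first by rewrite lt_min d10.
move=> s sz /allP Ps; apply: coc => //; apply/allP => p /Ps.
rewrite inE => -[z [u [Bz yz u01 tu ->]]].
have := UV (z, u); rewrite ballEmdist /=; apply; last by split=> //=; rewrite in_itv.
split=> /=; [apply: U1|apply: V2].
  by rewrite ballEmdist /=; apply: lt_le_trans yz _; rewrite ge_min lexx.
by rewrite /ball /=; apply: lt_le_trans tu _; rewrite ge_min lexx orbT.
Qed.

(** Continuity of [H] gives a radius for each [t]; half of it serves all nearby times, and
    compactness of [[0, 1]] makes it uniform. *)
Let cocycle_on_tubes y : B y ->
  exists2 d : R, 0 < d & forall t : R, 0 <= t <= 1 -> cocycle_on_tube y t d.
Proof.
move=> By.
have /compact_near_coveringP/(_ _ (0 : R)^'+ (fun d t => cocycle_on_tube y t d)) :=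
  @segment_compact R 0 1.
move=> cover.
have near0 : \forall d \near (0 : R)^'+, `[0, 1] `<=` (fun t => cocycle_on_tube y t d).
  apply: cover => t; rewrite /= in_itv /= => t01.
  have [d d0 coc] := cocycle_on_small_tube By t01.
  exists (ball t (d / 2), [set d' | 0 < d' < d / 2]) => /=.
    split; first by apply: nbhsx_ballx; rewrite divr_gt0.
    near=> d'; apply/andP; split; first by near: d'; exact: nbhs_right_gt.
    by near: d'; apply: nbhs_right_lt; rewrite divr_gt0.
  move=> [t' d'] /= [tt' /andP[d'0 d'd]].
  apply: cocycle_on_tubeS coc; first by rewrite mdistxx; lra.
  by move: tt'; rewrite /ball /=; lra.
near (0 : R)^'+ => d.
exists d; first by near: d; exact: nbhs_right_gt.
move=> t t01; have : `[0, 1] `<=` (fun t => cocycle_on_tube y t d) by near: d.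
by apply; rewrite /= in_itv.
Unshelve. all: by end_near. Qed.

(* A Lebesgue number for the covering of [{y} * [0, 1]] by tubes on which the
   pulled back [f] is a cocycle; being Lipschitz, it varies slowly with [y]. *)
Let tube_radius : exists L : X -> R,
  [/\ forall y, B y -> 0 < L y,
      forall y z, L y <= L z + mdist y z
    & forall y (t : R), B y -> 0 <= t <= 1 -> cocycle_on_tube y t (L y)].
Proof.
(* The cap 1 makes the supremum exist; it is halved because it may not be admissible itself. Tubes
   of radius 0 are empty, so [S y] is never empty. *)
pose S y := [set d : R | 0 <= d <= 1 /\ forall t : R, 0 <= t <= 1 -> cocycle_on_tube y t d].
have coc0 (y : X) (t d : R) : d <= 0 -> cocycle_on_tube y t d.
  move=> d0 [//|a s] _ /= /andP[]; rewrite inE => -[z [u [_ yz _ _ _]]].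
  by have := lt_le_trans yz d0; rewrite ltNge mdist_ge0.
have S0 y : S y 0 by split=> [|t _]; [rewrite lexx ler01|exact: coc0].
have supS y : has_sup (S y).
  by split; [exists 0|exists 1 => d [/andP[]]].
exists (fun y => sup (S y) / 2); split.
- move=> y By; have [d d0 coc] := cocycle_on_tubes By.
  rewrite divr_gt0 //; apply: (@lt_le_trans _ _ (Num.min d 1)).
    by rewrite lt_min d0 ltr01.
  apply: ub_le_sup; first by case: (supS y).
  split; first by rewrite le_min (ltW d0) ler01 ge_min lexx orbT.
  move=> t t01; apply: cocycle_on_tubeS (coc t t01).
    by rewrite mdistxx add0r ge_min lexx.
  by rewrite subrr normr0 add0r ge_min lexx.
- move=> y z; have yz0 := mdist_ge0 y z.
  suff : sup (S y) <= sup (S z) + mdist y z by lra.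
  apply: ge_sup; first by exists 0.
  move=> d [/andP[d0 d1] coc]; rewrite -lerBlDr.
  have [dz|dz] := leP d (mdist y z).
    by apply: (@le_trans _ _ 0); [lra|apply: ub_le_sup => //; case: (supS z)].
  apply: ub_le_sup; first by case: (supS z).
  split=> [|t t01]; first by apply/andP; split; lra.
  apply: cocycle_on_tubeS (coc t t01); first by lra.
  by rewrite subrr normr0 add0r; lra.
- move=> y t By t01.
  have [Sy0|Sy0] := leP (sup (S y)) 0; first by apply: coc0; lra.
  have Sy2 : 0 < sup (S y) / 2 by lra.
  have [d [d01 coc] dS] := sup_adherent Sy2 (supS y).
  apply: cocycle_on_tubeS (coc t t01); first by rewrite mdistxx; lra.
  by rewrite subrr normr0; lra.
Qed.

Let all_pred1_nseq n s : size s = n -> all (pred1 c) s -> s = nseq n c.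
Proof. by move=> <- /all_pred1P. Qed.

(** The homotopy is cut into steps [G j] whose length depends on the point, and the prisms between
    consecutive steps are summed. The boundary of the sum telescopes from the identity to the
    constant map [c]; the normalization kills the prisms between constant stages, so the sum is
    finite. *)
Lemma local_coboundary_of_vanishing : f (nseq q.+1 c) = 0 ->
  exists h : seq X -> K, forall y, B y -> exists2 e : R, 0 < e &
    forall s, size s = q.+1 -> all (fun z => mdist y z < e) s -> all (mem B) s ->
    f s = bd h s.
Proof.
move=> fc; have [L [L0 L_lip L_coc]] := tube_radius.
pose tau j z : R := Num.min 1 (j%:R * (L z / 4)).
have tau01 j z : B z -> 0 <= tau j z <= 1.
  move=> /L0 Lz; rewrite le_min ler01 ge_min lexx /= mulr_ge0 // divr_ge0 //.
  exact: ltW.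
have tau_lip j y z : tau j y <= tau j z + j%:R * (mdist y z / 4).
  have : j%:R * (L y / 4) <= j%:R * (L z / 4) + j%:R * (mdist y z / 4).
    by rewrite -mulrDr ler_wpM2l // -mulrDl ler_pM2r //.
  have : 0 <= j%:R * (mdist y z / 4) by rewrite mulr_ge0 // divr_ge0 // mdist_ge0.
  rewrite /tau.
  by case: (lerP 1 (j%:R * (L y / 4))); case: (lerP 1 (j%:R * (L z / 4))); lra.
have tau_step j y : B y -> tau j y <= tau j.+1 y /\ tau j.+1 y <= tau j y + L y / 4.
  move=> /L0 Ly; rewrite /tau -[j.+1%:R]natr1 mulrDl mul1r.
  by case: (lerP 1 (j%:R * (L y / 4))); case: (lerP 1 (j%:R * (L y / 4) + _)); lra.
pose G j z := H (z, tau j z).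
(* After [J z] steps of length [L z / 4] time 1 is reached. *)
pose J z := (Num.truncn (4 / L z)).+1.
have G_c j z : B z -> (J z <= j)%N -> G j z = c.
  move=> Bz Jj; rewrite /G (_ : tau j z = 1) ?H1 //; apply/min_idPl.
  have Lz := L0 _ Bz; rewrite -ler_pdivrMr ?divr_gt0 // div1r invf_div.
  by apply: (@le_trans _ _ (J z)%:R); [exact/ltW/truncnS_gt|rewrite ler_nat].
pose T j s := prism (G j) (G j.+1) f s.
have T0 j s : size s = q -> all (fun z => (z \in B) && (J z <= j)%N) s -> T j s = 0.
  move=> sq /allP Js; apply: (@prism_eq0 _ _ _ _ (pred1 c)) => [t ts /all_pred1_nseq tc|].
    by rewrite (tc q.+1) ?fc // ts sq.
  apply/allP => z /Js /andP[]; rewrite inE => Bz Jz.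
  by rewrite /= !G_c ?eqxx // ltnW.
pose h s := - \sum_(j < \max_(z <- s) J z) T j s.
have hE M s : size s = q -> all (fun z => (z \in B) && (J z <= M)%N) s ->
    h s = - \sum_(j < M) T j s.
  move=> sq sM; congr (- _).
  have le_M : (\max_(z <- s) J z <= M)%N.
    by apply/bigmax_leqP_seq => z zs _; have /andP[] := allP sM z zs.
  rewrite -!(big_mkord xpredT (T^~ s)).
  rewrite [RHS](big_cat_nat (n := \max_(z <- s) J z)) //=.
  rewrite [X in _ + X]big_nat [X in _ + X]big1 ?addr0 // => j /andP[sj _].
  apply: T0 => //; apply/allP => z zs; have /andP[-> _] := allP sM z zs.
  by apply: leq_trans sj; apply: leq_bigmax_seq.
exists h => y By; have Ly := L0 _ By.
(* Within [L y / 2] of [y] one has [L z >= L y / 2], hence [J z <= N]. The choice of [e] keeps the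
   drift between [tau j y] and [tau j z] over [N] steps below the tube radius. *)
pose N := (Num.truncn (8 / L y)).+1.
pose e := L y / N.+3%:R.
have N3 : (0 : R) < N.+3%:R by rewrite ltr0n.
have eN : e * N.+3%:R = L y by rewrite divfK // gt_eqF.
have e0 : 0 < e by rewrite divr_gt0.
have e2 : e <= L y / 2.
  have : e * 2 <= e * N.+3%:R by rewrite ler_pM2l // ler_nat.
  by rewrite eN; lra.
exists e => // s sq ys Bs.
have JN : all (fun z => (z \in B) && (J z <= N)%N) s.
  apply/allP => z zs; have yz := allP ys z zs; have := allP Bs z zs.
  rewrite inE => Bz; rewrite mem_set //= ltnS le_truncn //.
  have Lyz := L_lip y z; have Lz := L0 _ Bz.
  rewrite ler_pdivrMr // mulrAC ler_pdivlMr //; lra.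
have -> : bd h s = - \sum_(j < N) bd (T j) s.
  rewrite -bd_sum -bdN; apply: eq_bd JN => t; rewrite sq => tq tN.
  exact: hE.
have bdT (j : nat) : (j < N)%N ->
    bd (T j) s = f (map (G j.+1) s) - f (map (G j) s).
  (* Both [G j] and [G j.+1] send the entries of [s] into the tube of radius [L y] at
     [(y, tau j y)], where [bd f] vanishes. *)
  move=> jN; rewrite bd_prism [X in _ - X](_ : _ = 0) ?subr0 //.
  apply: (@prism_eq0 _ _ _ _ (mem (tube y (tau j y) (L y)))) => [t|].
    by rewrite sq; apply: L_coc => //; exact: tau01.
  apply/allP => z zs; have yz := allP ys z zs; have := allP Bs z zs.
  rewrite inE => Bz.
  have dyz : mdist y z < L y by lra.
  have dN : j.+1%:R * (mdist y z / 4) <= L y / 4.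
    rewrite mulrA ler_pM2r // -eN mulrC ler_pM ?mdist_ge0 ?(ltW yz) //.
    by rewrite ler_nat; lia.
  have zy := metric_sym y z; have d0 := mdist_ge0 y z.
  have Sj : j.+1%:R = j%:R + 1 :> R by rewrite -natr1.
  have lip1 := tau_lip j y z; have lip2 := tau_lip j z y.
  have lip3 := tau_lip j.+1 y z; have lip4 := tau_lip j.+1 z y.
  have [st1 st2] := tau_step j _ By.
  rewrite Sj in dN lip3 lip4; rewrite -zy in lip2 lip4.
  apply/andP; split; rewrite inE; exists z.
    by exists (tau j z); split=> //; [exact: tau01|rewrite ltr_norml; lra].
  by exists (tau j.+1 z); split=> //; [exact: tau01|rewrite ltr_norml; lra].
rewrite (eq_bigr (fun j : 'I_N => f (map (G j.+1) s) - f (map (G j) s))); last first.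
  by move=> j _; exact: bdT.
rewrite -(big_mkord xpredT (fun j => f (map (G j.+1) s) - f (map (G j) s))).
rewrite telescope_sumr // opprB.
rewrite [X in _ = _ - f X](_ : _ = nseq q.+1 c); last first.
  apply: all_pred1_nseq; rewrite ?size_map // all_map; apply/allP => z zs.
  have /andP[] := allP JN z zs; rewrite inE /= => Bz Jz.
  by rewrite G_c.
rewrite fc subr0; congr f; rewrite -[LHS]map_id; apply/eq_in_map => z zs.
have := allP Bs z zs; rewrite inE => Bz.
rewrite /G /tau mul0r (_ : Num.min _ _ = 0) ?H0 //.
by apply/min_idPr.
Qed.

End NullHomotopicInclusion.

(** Subtracting the coboundary of the constant [k] normalizes [f] at [c]: for [q] even that
    coboundary equals [k] there, and for [q] odd the cocycle condition at [c] already forces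
    [k = 0]. *)
Lemma local_coboundary_of_contraction (R : realType) (X : metricType R)
    (K : pzRingType) (B C : set X) (f : seq X -> K) q :
  contractible_inside B C ->
  (forall y, C y -> exists2 e : R, 0 < e &
    forall s, size s = q.+2 -> all (fun z => mdist y z < e) s -> bd f s = 0) ->
  exists h : seq X -> K,
  forall y, B y -> exists2 e : R, 0 < e &
    forall s, size s = q.+1 -> all (fun z => mdist y z < e) s -> all (mem B) s ->
    f s = bd h s.
Proof.
move=> [BC [H [c [Hc HC H0 H1 Cc]]]] coc.
pose k := f (nseq q.+1 c); pose g t := f t - bd (fun=> k) t.
have bdg s : bd g s = bd f s by rewrite bdB bd_bd subr0.
have [||h hg] := @local_coboundary_of_vanishing _ _ K B C H c Hc HC H0 H1 g q.
- move=> y /coc[e e0 se]; exists e => // s; rewrite bdg; exact: se.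
- have : bd f (nseq q.+2 c) = 0.
    have [e e0 ->] := coc _ Cc; rewrite ?size_nseq //.
    by apply/allP => z; rewrite mem_nseq => /eqP ->; rewrite mdistxx.
  have -> : bd f (nseq q.+2 c) = bd (fun=> k) (nseq q.+2 c).
    apply: (@eq_bd _ _ (pred1 c)); last by rewrite all_nseq /= eqxx.
    by move=> t; rewrite size_nseq => tq /all_pred1P ->; rewrite tq.
  rewrite /g !bd_const !size_nseq /= -/k; case: odd => /=; first by rewrite subr0.
  by rewrite subrr.
exists (fun t => h t + k) => y /hg[e e0 se]; exists e => // s sq ys Bs.
by rewrite bdD -se // subrK.
Qed.

(** * Functions vanishing near the diagonal at infinity *)

Section CommonRadius.
Context {R : realType} (T : eqType) (P : T -> R -> Prop).
Hypothesis P_antitone : forall x d e, d <= e -> P x e -> P x d.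

Lemma common_radius (l : seq T) :
  (forall x, x \in l -> exists2 e : R, 0 < e & P x e) ->
  exists2 e : R, 0 < e & forall x, x \in l -> P x e.
Proof.
elim: l => [|x l IH] Pl; first by exists 1.
have [|e e0 Pe] := IH; first by move=> y yl; apply: Pl; rewrite inE yl orbT.
have [d d0 Pd] := Pl x (mem_head _ _).
exists (Num.min d e) => [|y]; first by rewrite lt_min d0.
rewrite inE => /orP[/eqP ->|/Pe]; first by apply: P_antitone Pd; rewrite ge_min lexx.
by apply: P_antitone; rewrite ge_min lexx orbT.
Qed.

End CommonRadius.

Section Words.
Variable T : eqType.

Fixpoint words n (L : seq T) : seq (seq T) :=
  if n is m.+1 then [seq a :: t | a <- L, t <- words m L] else [:: [::]].

Lemma mem_words n L t : size t = n -> all (mem L) t -> t \in words n L.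
Proof.
elim: n t => [[]//|n IH] [//|a t] [tn] /= /andP[aL tL].
by apply: allpairs_f => //; exact: IH.
Qed.

Fixpoint faces (s : seq T) : seq (seq T) :=
  if s is a :: s' then s' :: [seq a :: t | t <- faces s'] else [::].

Lemma size_face s t : t \in faces s -> (size t).+1 = size s.
Proof.
elim: s t => //= a s IH t; rewrite inE => /orP[/eqP -> //|/mapP[u /IH <- -> //]].
Qed.

Lemma all_face (P : pred T) s t : t \in faces s -> all P s -> all P t.
Proof.
elim: s t => //= a s IH t; rewrite inE => /orP[/eqP -> /andP[]//|].
by move=> /mapP[u us ->] /andP[Pa Ps] /=; rewrite Pa; exact: IH.
Qed.

Lemma bd_faces0 (K : pzRingType) (phi : seq T -> K) s :
  (forall t, t \in faces s -> phi t = 0) -> bd phi s = 0.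
Proof.
elim: s phi => //= a s IH phi phi0; rewrite phi0 ?mem_head // IH ?subrr // => t ts.
by apply: phi0; rewrite inE map_f ?orbT.
Qed.

End Words.

Section Vanishing.
Context {R : realType} {X : metricType R} (K : pzRingType) (b : X).
Implicit Types (f g w h : seq X -> seq X -> K) (phi psi : seq X -> K).

(* For [p = n], [q = 0] this is the coarse support condition on cochains of
   degree [n - 1], for [p = 0], [q = n] the bounded support condition. *)
Definition vanishing p q f := forall r : R, exists S : R, forall x y,
  size x = p -> all (fun a => mdist y a <= r) x -> S <= mdist b y ->
  exists2 e : R, 0 < e &
    forall s, size s = q -> all (fun z => mdist y z < e) s -> f x s = 0.

Lemma eq_vanishing p q f g :
  (forall x s, size x = p -> size s = q -> f x s = g x s) ->
  vanishing p q f -> vanishing p q g.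
Proof.
move=> fg Nf r; have [S NS] := Nf r; exists S => x y xp xy yS.
by have [e e0 se] := NS x y xp xy yS; exists e => // s sq ys; rewrite -fg // se.
Qed.

Lemma vanishing0 p q : vanishing p q (fun _ _ => 0).
Proof. by move=> r; exists 0 => x y _ _ _; exists 1. Qed.

Lemma vanishingD p q f g : vanishing p q f -> vanishing p q g ->
  vanishing p q (fun x s => f x s + g x s).
Proof.
move=> Nf Ng r; have [S NS] := Nf r; have [T NT] := Ng r.
exists (Num.max S T) => x y xp xy; rewrite ge_max => /andP[yS yT].
have [d d0 sd] := NS x y xp xy yS; have [e e0 se] := NT x y xp xy yT.
exists (Num.min d e) => [|s sq ys]; first by rewrite lt_min d0.
have ysd : all (fun z => mdist y z < d) s.
  by apply: sub_all ys => z; rewrite lt_min => /andP[].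
have yse : all (fun z => mdist y z < e) s.
  by apply: sub_all ys => z; rewrite lt_min => /andP[].
by rewrite sd // se // addr0.
Qed.

Lemma vanishingZ p q c f : vanishing p q f -> vanishing p q (fun x s => c * f x s).
Proof.
move=> Nf r; have [S NS] := Nf r; exists S => x y xp xy yS.
by have [e e0 se] := NS x y xp xy yS; exists e => // s sq ys; rewrite se ?mulr0.
Qed.

Lemma vanishingB p q f g : vanishing p q f -> vanishing p q g ->
  vanishing p q (fun x s => f x s - g x s).
Proof.
move=> Nf Ng; apply: eq_vanishing (vanishingD Nf (vanishingZ (-1) Ng)).
by move=> x s _ _; rewrite mulN1r.
Qed.

Lemma vanishing_bdl p q f :
  vanishing p q f -> vanishing p.+1 q (fun x s => bd (f^~ s) x).
Proof.
move=> Nf r; have [S NS] := Nf r; exists S => x y xp xy yS.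
pose P x' e := forall s, size s = q -> all (fun z => mdist y z < e) s -> f x' s = 0.
have [||e e0 Pe] := @common_radius R _ P _ (faces x).
- move=> x' d e de Pe s sq ys; apply: Pe => //.
  by apply: sub_all ys => z /lt_le_trans; apply.
- move=> x' xx'; apply: (NS x' y _ (all_face xx' xy) yS).
  by apply: succn_inj; rewrite (size_face xx').
by exists e => // s sq ys; apply: bd_faces0 => x' /Pe; apply.
Qed.

Lemma vanishing_cat p q phi : vanishing (p + q) 0 (fun x _ => phi x) ->
  vanishing p q (fun x s => phi (x ++ s)).
Proof.
move=> Nphi r; have [S NS] := Nphi (Num.max r 1); exists S => x y xp xy yS.
exists 1 => // s sq ys; have [|||e e0 /(_ [::])] := NS (x ++ s) y.
- by rewrite size_cat xp sq.
- rewrite all_cat; apply/andP; split.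
    by apply: sub_all xy => a ya; rewrite le_max ya.
  by apply: sub_all ys => a ya; rewrite le_max (ltW ya) orbT.
- by [].
exact.
Qed.

Lemma vanishing_CB_CX n phi : vanishing n 0 (fun x _ => phi x) ->
  vanishing 0 n (fun _ s => phi s).
Proof.
by move=> /(@vanishing_cat 0 n); apply: eq_vanishing => -[|//] s.
Qed.

(** Every neighbourhood of [y] contains [y], so a function constant in the second variable vanishes
    outright. *)
Lemma vanishing_const p phi : vanishing p 1 (fun x _ => phi x) ->
  vanishing p 0 (fun x _ => phi x).
Proof.
move=> N r; have [S NS] := N r; exists S => x y xp xy yS.
have [e e0 se] := NS x y xp xy yS; exists 1 => // s _ _.
by apply: (se [:: y]); rewrite //= mdistxx e0.
Qed.

Section Pi.
Variable pi : X -> X.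
Hypothesis pi_near : forall y, mdist y (pi y) < 2.
Hypothesis pi_locally_finite : forall y, exists2 e : R, 0 < e &
  exists L : seq X, forall z, mdist y z < e -> pi z \in L.

Lemma vanishing_map n phi : vanishing n 0 (fun x _ => phi x) ->
  vanishing n 0 (fun x _ => phi (map pi x)).
Proof.
move=> N r; have [S NS] := N (r + 2); exists S => x y xp xy yS.
have [|||e e0 se] := NS (map pi x) y; rewrite ?size_map //; last by exists e.
rewrite all_map; apply: sub_all xy => a /= ya.
by apply: le_trans (metric_triangle _ a _) (lerD ya (ltW (pi_near a))).
Qed.

(** For [s] near [y] the moved front face is one of finitely many words in [L], so a common radius
    exists. The faces share one entry, whence the length [p + q.+1]. *)
Lemma vanishing_front_back p q w : vanishing p.+1 q.+1 w ->
  vanishing 0 (p + q.+1) (fun _ s => front_back pi p w s).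
Proof.
(* The radius 3 is 1 for the distance from [y] to [s] plus 2 for the displacement by [pi]. *)
move=> Nw r; have [S NS] := Nw 3; exists S => x0 y _ _ yS.
have [d d0 [L piL]] := pi_locally_finite y.
pose P x e := all (fun a => mdist y a <= 3) x ->
  forall s, size s = q.+1 -> all (fun z => mdist y z < e) s -> w x s = 0.
have [||e e0 Pe] := @common_radius R _ P _ [seq x <- words p.+1 L | size x == p.+1].
- move=> x' e' e de Pe yx s sq ys; apply: Pe => //.
  by apply: sub_all ys => z /lt_le_trans; apply.
- move=> x; rewrite mem_filter => /andP[/eqP xp _].
  have [y3|y3] := boolP (all (fun a => mdist y a <= 3) x).
    by have [e e0 se] := NS x y xp y3 yS; exists e => // _.
  by exists 1 => // /(negP y3).
exists (Num.min (Num.min d e) 1) => [|s sq /allP ys].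
  by rewrite !lt_min d0 e0 /=.
have {}ys z : z \in s -> [/\ mdist y z < d, mdist y z < e & mdist y z < 1].
  by move=> /ys; rewrite !lt_min => /andP[/andP[]].
have sp : size (map pi (take p.+1 s)) = p.+1.
  by rewrite size_map size_takel // sq; lia.
rewrite /front_back Pe //.
- rewrite mem_filter sp eqxx mem_words // all_map; apply/allP => z /mem_take zs.
  by rewrite /= piL //; case: (ys z zs).
- rewrite all_map; apply/allP => z /mem_take zs /=; have [_ _ yz] := ys z zs.
  by have := metric_triangle y z (pi z); have := pi_near z; lra.
- by rewrite size_drop sq; lia.
- by apply/allP => z /mem_drop zs; case: (ys z zs).
Qed.

End Pi.
End Vanishing.

(** * The double complex *)

Section RowExactness.
Context {R : realType} {X : metricType R} (K : pzRingType) (b : X).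

(** Contractibility is applied at the exact diameter of the ball, which is only known to be at most
    [d]; monotonicity of [rho] and [mu] passes to [d]. *)
Lemma closed_ball_contractible (rho mu : {nonneg R} -> {nonneg R}) :
  {homo rho : r s / r <= s} -> {homo mu : r s / r <= s} ->
  (forall (r : {nonneg R}) (B : set X),
     diam B = r%:num%:E -> ((mu r)%:num%:E <= set_dist b B)%E ->
     exists2 C : set X, (diam C <= (rho r)%:num%:E)%E & contractible_inside B C) ->
  forall (m : R) (d : {nonneg R}) a, 0 <= m -> m + m <= d%:num ->
  (mu d)%:num + m <= mdist b a ->
  exists2 C : set X, contractible_inside [set z | mdist a z <= m] C &
    forall z, C z -> mdist a z <= (rho d)%:num.
Proof.
move=> rho_le mu_le contr m d a m0 md bm; set B := [set z | _].
have Ba : B a by rewrite /B /= mdistxx.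
have D0 : (0 <= diam B)%E by apply: ereal_sup_ubound; left.
have D2 : (diam B <= d%:num%:E)%E.
  apply: ge_ereal_sup => _ [->|[[y z] [/= By Bz] <-]]; first by rewrite lee_fin.
  rewrite lee_fin; apply: le_trans (metric_triangle y a z) _; apply: le_trans md.
  by apply: lerD => //; rewrite metric_sym.
have Dfin : diam B \is a fin_num.
  by rewrite ge0_fin_numE //; apply: le_lt_trans D2 _; rewrite ltry.
have d0 : 0 <= fine (diam B) by apply: fine_ge0.
pose r := NngNum d0.
have rd : r <= d.
  by rewrite -[X in is_true X]lee_fin /= fineK.
have [||C diamC BC] := contr r B; first by rewrite /= fineK.
  apply: le_ereal_inf_tmp => _ [z Bz <-]; rewrite lee_fin.
  have : (mu r)%:num <= (mu d)%:num by exact: mu_le.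
  by have := metric_triangle b z a; rewrite (metric_sym z a); move: Bz; rewrite /B /=; lra.
exists C => // z Cz; rewrite -lee_fin; apply: le_trans (_ : diam C <= _)%E.
  by apply: ereal_sup_ubound; right; exists (a, z) => //; split=> //; case: BC => + _; apply.
by apply: le_trans diamC _; rewrite lee_fin; exact: rho_le.
Qed.

Local Notation neg := (@vanishing R X K b).

Variables (rho mu : {nonneg R} -> {nonneg R}).
Hypothesis rho_le : {homo rho : r s / r <= s}.
Hypothesis mu_le : {homo mu : r s / r <= s}.
Hypothesis contr : forall (r : {nonneg R}) (B : set X),
  diam B = r%:num%:E -> ((mu r)%:num%:E <= set_dist b B)%E ->
  exists2 C : set X, (diam C <= (rho r)%:num%:E)%E & contractible_inside B C.

Let primitive_on_ball p q f (m : nat) :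
  neg p.+1 q.+2 (fun x s => bd (f x) s) ->
  exists S : R, m%:R <= S /\ forall a x, size x = p ->
    all (fun z => mdist a z <= m%:R) x -> S <= mdist b a ->
    exists h : seq X -> K, forall y, mdist a y <= m%:R ->
      exists2 e : R, 0 < e & forall s, size s = q.+1 ->
        all (fun z => mdist y z < e) s -> all (fun z => mdist a z <= m%:R) s ->
        f (a :: x) s = bd h s.
Proof.
move=> Nf; have m0 : (0 : R) <= m%:R by [].
pose d : {nonneg R} := NngNum (addr_ge0 m0 m0).
have [S NS] := Nf ((rho d)%:num + m%:R).
(* The three bounds serve, in order, to limit the usable [m] for a given [a], to put all of [C]
   where [bd (f (a :: x))] vanishes locally, and to make the ball contractible in [C]. *)
exists (Num.max (Num.max m%:R (S + (rho d)%:num)) ((mu d)%:num + m%:R)); split.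
  by rewrite !le_max lexx.
move=> a x xp ax; rewrite !ge_max => /andP[/andP[am aS] amu].
have [C BC Cr] := closed_ball_contractible rho_le mu_le contr m0 (lexx d%:num) amu.
have [|h hf] := @local_coboundary_of_contraction R X K _ C (f (a :: x)) q BC.
  move=> y /Cr ay; apply: NS; first by rewrite /= xp.
    have ya : mdist y a <= (rho d)%:num by rewrite metric_sym.
    rewrite /=; apply/andP; split; first by lra.
    apply: sub_all ax => z az; apply: le_trans (metric_triangle y a z) _.
    exact: lerD.
  have := metric_triangle b y a; rewrite (metric_sym y a).
  by lra.
exists h => y /hf[e e0 se]; exists e => // s sq ys am'; apply: se => //.
by apply: sub_all am' => z az; rewrite inE.
Qed.

(** One primitive for each [x] must serve all radii [r], so it is taken on the largest ball around
    the head of [x] on which one is available. A largest one exists because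
    [m <= S m <= mdist b a]. *)
Lemma row_exact p q f : neg p.+1 q.+2 (fun x s => bd (f x) s) ->
  exists h, neg p.+1 q.+1 (fun x s => f x s - bd (h x) s).
Proof.
move=> Nf; have /choice[S SP] := fun m => primitive_on_ball m Nf.
have /choice[h hP] : forall x, exists h : seq X -> K,
    if x is a :: x' then forall m : nat,
      size x' = p -> all (fun z => mdist a z <= m%:R) x' -> S m <= mdist b a ->
      forall y, mdist a y <= m%:R ->
      exists2 e : R, 0 < e & forall s, size s = q.+1 ->
        all (fun z => mdist y z < e) s -> all (fun z => mdist a z <= m%:R) s ->
        f x s = bd h s
    else True.
  case=> [|a x]; first by exists (fun=> 0).
  pose good m := [&& size x == p, all (fun z => mdist a z <= m%:R) x & S m <= mdist b a].
  have [ex_good|none] := pselect (exists m, good m); last first.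
    by exists (fun=> 0) => m xp xm Sm; case: none; exists m; rewrite /good xp eqxx xm.
  have good_le m : good m -> (m <= Num.truncn (mdist b a))%N.
    case: (SP m) => mS _ /and3P[_ _ Sm]; have mb := le_trans mS Sm.
    by rewrite -(@natrK R m) le_truncn.
  case: (ex_maxnP ex_good good_le) => M /and3P[/eqP xp xM SM] maxM.
  have [h hM] := (SP M).2 a x xp xM SM.
  exists h => m _ xm Sm y ay.
  have mM : m%:R <= M%:R :> R by rewrite ler_nat maxM // /good xp eqxx xm.
  have [e e0 se] := hM y (le_trans ay mM); exists e => // s sq ys am.
  by apply: se => //; apply: sub_all am => z /le_trans; apply.
(* If [x] is within [r] and [s] within 1 of [y], all entries lie within [2 * r + 1] of the head of
   [x]. *)
exists h => r; pose m := (Num.truncn (2 * r + 1)).+1.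
have rm : 2 * r + 1 < m%:R by exact: truncnS_gt.
exists (S m + r) => -[//|a x] y [xp] /= /andP[ya yx] yS.
have ay : mdist a y <= r by rewrite metric_sym.
have r0 : 0 <= r := le_trans (mdist_ge0 _ _) ay.
have [|||e e0 se] := hP (a :: x) m xp _ _ y.
- apply: sub_all yx => z yz.
  by have := metric_triangle a y z; lra.
- by have := metric_triangle b a y; lra.
- by lra.
exists (Num.min e 1) => [|s sq /allP ys]; first by rewrite lt_min e0 ltr01.
rewrite se ?subrr //; apply/allP => z /ys; rewrite lt_min => /andP[//].
by move=> _ yz; have := metric_triangle a y z; lra.
Qed.

(** Zigzag towards functions of [x] alone: a row primitive [h'] of the current term is
    differentiated in [x], and [bd_cat] turns the result into the hypothesis for [p.+1], with the
    sign absorbed in [k]. At [q = 0] the augmentation evaluates [y] at the empty list. *)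
Lemma primitive_up_to_CX n phi : neg n.+1 0 (fun x _ => bd phi x) ->
  forall q p k h, (p + q).+1 = n ->
    neg p.+1 q.+1 (fun x s => bd (fun y => (-1) ^+ k * phi (x ++ y) - bd (h^~ y) x) s) ->
  exists theta, neg n 0 (fun x _ => phi x - bd theta x).
Proof.
move=> Nphi; elim=> [|q IH] p k h pq Nw.
  exists (fun x => (-1) ^+ k * h x [::]); rewrite -pq addn0.
  apply: vanishing_const; apply: eq_vanishing (vanishingZ ((-1) ^+ k) Nw).
  move=> x [|y [|? ?]] //= xp _.
  by rewrite cats0 subr0 mulrBr signrMK bdZ.
have [h' Nh'] := row_exact Nw.
apply: (IH p.+1 (k + p).+1 h'); first by rewrite -pq addnS.
have Ncat : neg p.+2 q.+1 (fun x s => bd phi (x ++ s)).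
  by apply: vanishing_cat; rewrite (_ : (p.+2 + q.+1)%N = n.+1) // -pq; lia.
apply: eq_vanishing (vanishingB (vanishing_bdl Nh') (vanishingZ ((-1) ^+ k) Ncat)).
move=> x s xp sq /=; rewrite bd_cat xp !bdB !bdZ bd_exchange.
rewrite bd_bd subr0 mulrDr opprD addrA [_ - bd _ s - _]addrAC subrr add0r addrC.
by rewrite !exprS !mulN1r opprK mulrA -exprD mulNr.
Qed.

Section Pi.
Variable pi : X -> X.
Hypothesis pi_near : forall y, mdist y (pi y) < 2.
Hypothesis pi_locally_finite : forall y, exists2 e : R, 0 < e &
  exists L : seq X, forall z, mdist y z < e -> pi z \in L.

(** The zigzag for a class killed by both differentials: [w] is replaced by the [x]-differential of
    its row primitive [h], and [bd_front_back] shows that modulo CB this changes the front-back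
    cochain by a coboundary and a sign. At the end [alpha] is the value of [h] at the empty list,
    with [x] moved by [pi]. *)
Lemma front_back_cohomologous q : forall p w,
  neg p.+1 q.+2 (fun x s => bd (w x) s) -> neg p.+2 q.+1 (fun x s => bd (w^~ s) x) ->
  exists alpha theta, neg (p + q).+2 0 (fun x _ => bd alpha x) /\
    neg 0 (p + q).+1 (fun _ s => front_back pi p w s - alpha s - bd theta s).
Proof.
elim: q => [|q IH] p w Nr Nl; have [h Nh] := row_exact Nr.
  exists (fun s => h (map pi s) [::]), (fun=> 0); rewrite addn0; split.
    have Nh0 : neg p.+2 0 (fun x _ => bd (h^~ [::]) x).
      apply: vanishing_const.
      apply: eq_vanishing (vanishingB Nl (vanishing_bdl Nh)) => x [|y [|? ?]] //= _ _.
      by rewrite bdB opprB addrC subrK; apply: eq_bdT => t _; rewrite subr0.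
    apply: eq_vanishing (vanishing_map pi_near Nh0) => x s _ _.
    by rewrite (bd_map pi (h^~ [::])).
  have := vanishing_front_back pi_near pi_locally_finite Nh; rewrite addn1.
  apply: eq_vanishing => x s _ sp; rewrite /front_back bd0 subr0.
  rewrite (take_oversize (n := p.+1)) ?sp //; congr (_ - _).
  have : size (drop p s) = 1%N by rewrite size_drop sp subSnn.
  by case: (drop p s) => [|y [|? ?]] //= _; rewrite subr0.
pose w' x s := bd (h^~ s) x.
have [||alpha [theta [Na Nt]]] := IH p.+1 w'.
- apply: eq_vanishing (vanishingB Nl (vanishing_bdl Nh)) => x s _ _.
  by rewrite bdB opprB addrC subrK bd_exchange.
- by apply: eq_vanishing (vanishing0 _ _ _ _) => x s _ _; rewrite bd_bd.
exists (fun s => - (-1) ^+ p * alpha s).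
exists (fun s => (-1) ^+ p * (front_back pi p h s - theta s)); split.
  rewrite addnS; apply: eq_vanishing (vanishingZ (- (-1) ^+ p) Na) => x s _ _.
  by rewrite bdZ.
have Nf := vanishing_front_back pi_near pi_locally_finite Nh.
rewrite addnS in Nf; rewrite addSn -addnS in Nt.
apply: eq_vanishing (vanishingD Nf (vanishingZ (- (-1) ^+ p) Nt)) => x s _ sq.
rewrite bdZ bdB bd_front_back; last by rewrite sq; lia.
rewrite -/w'.
have -> : front_back pi p (fun x s => w x s - bd (h x) s) s =
  front_back pi p w s - front_back pi p (fun x s => bd (h x) s) s by [].
rewrite !mulrBr mulrDr !mulNr signrMK !opprD !opprK !addrA.
by rewrite [RHS](ACl (1*4*3*2*5)%AC).
Qed.

End Pi.

(** A primitive [theta] of [phi] modulo CX need not lie in CB, but [bd theta] does. Modulo CB,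
    [theta] is thus a cocycle, cohomologous to some [alpha] that is a cocycle modulo CX; subtracting
    [alpha] and [bd theta'] brings it into CB. *)
Lemma CB_mod_CX_acyclic n phi : neg 0 n.+2 (fun _ s => phi s) ->
  neg n.+3 0 (fun x _ => bd phi x) ->
  exists psi, neg 0 n.+1 (fun _ s => psi s) /\
    neg n.+2 0 (fun x _ => phi x - bd psi x).
Proof.
move=> Bphi Xdphi; have [pi [pi_near pi_fin]] := @locally_finite_map R X.
have [theta Xtheta] : exists theta, neg n.+2 0 (fun x _ => phi x - bd theta x).
  (* The zigzag starts with [h = 0], since [bd] of [phi (a :: _)] at [s] is
     [phi s - bd phi (a :: s)], where [phi] is in CB and [bd phi] in CX. *)
  apply: (primitive_up_to_CX Xdphi (q := n.+1) (p := 0) (k := 0) (h := fun _ _ => 0)).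
    by [].
  have N1 : neg 1 n.+2 (fun x s => bd phi (x ++ s)) by exact: vanishing_cat.
  have N2 : neg 1 n.+2 (fun _ s => phi s).
    move=> r; have [S NS] := Bphi r; exists S => x y _ _ yS.
    exact: (NS [::] y).
  apply: eq_vanishing (vanishingB N2 N1) => -[|a [|? ?]] //= s _ _.
  rewrite expr0 opprB addrC subrK; apply: eq_bdT => t _.
  by rewrite mul1r subrr subr0.
have Bdtheta : neg 0 n.+2 (fun _ s => bd theta s).
  apply: eq_vanishing (vanishingB Bphi (vanishing_CB_CX Xtheta)) => x s _ _.
  by rewrite opprB addrC subrK.
have [||alpha [theta' [Xalpha Bpsi]]] :=
  front_back_cohomologous pi_near pi_fin (q := n) (p := 0) (w := fun _ s => theta s).
- move=> r; have [S NS] := Bdtheta r; exists S => x y _ _ yS.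
  exact: (NS [::] y).
- apply: eq_vanishing (vanishing0 _ _ _ _) => -[|a [|c [|? ?]]] //= s _ _.
  by rewrite subr0 subrr.
exists (fun s => theta s - alpha s - bd theta' s); split.
  by apply: eq_vanishing Bpsi => x s _ _; rewrite /front_back drop0.
apply: eq_vanishing (vanishingD Xtheta Xalpha) => x s _ _.
by rewrite !bdB bd_bd subr0 opprB addrA addrAC.
Qed.

(** A one-entry tuple lies on the diagonal, so a local condition at it already determines its
    value. *)
Lemma CB_CX_degree0 phi : neg 0 1 (fun _ s => phi s) -> neg 1 0 (fun x _ => phi x).
Proof.
move=> N r; have [S NS] := N r; exists (S + r) => -[|a [|? ?]] //= y _ /andP[ya _] yS.
have [|||e e0 se] := NS [::] a => //.
  by have := metric_triangle b a y; rewrite (metric_sym a y); lra.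
by exists 1 => // s _ _; apply: se; rewrite //= mdistxx e0.
Qed.

End RowExactness.

(** * Coarse and boundedly supported cochains *)

Section Deletion.
Variables (X : Type) (K : pzRingType).

Lemma bd_sum_deletion (psi : seq X -> K) s :
  bd psi s = \sum_(i < size s) (-1) ^+ i * psi (take i s ++ drop i.+1 s).
Proof.
elim: s psi => [|a s IH] psi /=; first by rewrite big_ord0.
rewrite big_ord_recl /= drop0 expr0 mul1r IH -sumrN; congr (_ + _).
by apply: eq_bigr => i _; rewrite exprS mulN1r mulNr.
Qed.

Definition row_seq n (v : 'rV[X]_n) : seq X := [seq v 0 i | i <- enum 'I_n].

Definition seq_cochain n (psi : seq X -> K) : cochain X K n :=
  fun v => psi (row_seq v).
Arguments seq_cochain : clear implicits.

Lemma size_row_seq n (v : 'rV[X]_n) : size (row_seq v) = n.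
Proof. by rewrite size_map size_enum_ord. Qed.

Lemma nth_row_seq x0 n (v : 'rV[X]_n) (i : 'I_n) : nth x0 (row_seq v) i = v 0 i.
Proof. by rewrite (nth_map i) ?size_enum_ord // nth_ord_enum. Qed.

Lemma row_seqK x0 n (v : 'rV[X]_n) : \row_(i < n) nth x0 (row_seq v) i = v.
Proof. by apply/rowP => i; rewrite mxE nth_row_seq. Qed.

Lemma row_of_seqK x0 n (s : seq X) : size s = n ->
  row_seq (\row_(i < n) nth x0 s i) = s.
Proof.
move=> sn; apply: (@eq_from_nth _ x0) => [|i]; rewrite size_row_seq // => ltin.
by rewrite (nth_row_seq _ _ (Ordinal ltin)) mxE.
Qed.

Lemma all_row_seq (P : pred X) n (v : 'rV[X]_n) :
  (forall i, P (v 0 i)) <-> all P (row_seq v).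
Proof.
split=> [Pv|]; first by rewrite all_map; apply/allP => i _; exact: Pv.
by rewrite all_map => /allP Pv i; apply: Pv; rewrite mem_enum.
Qed.

Lemma row_seq_col' n (v : 'rV[X]_n.+1) (i : 'I_n.+1) :
  row_seq (col' i v) = take i (row_seq v) ++ drop i.+1 (row_seq v).
Proof.
have x0 := v 0 0.
have szt : size (take i (row_seq v)) = i by rewrite size_takel // size_row_seq ltnW.
apply: (@eq_from_nth _ x0) => [|j].
  by rewrite size_cat szt size_drop !size_row_seq; have := ltn_ord i; lia.
rewrite size_row_seq => ltjn.
rewrite (nth_row_seq _ _ (Ordinal ltjn)) mxE nth_cat szt -(nth_row_seq x0) /= /bump.
case: ltnP => [ji|ij]; first by rewrite nth_take.
by rewrite nth_drop; congr nth; lia.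
Qed.

Lemma cochain_diff_seq n (psi : seq X -> K) :
  cochain_diff (seq_cochain n psi) = seq_cochain n.+1 (bd psi).
Proof.
apply/funext => v; rewrite /seq_cochain bd_sum_deletion size_row_seq.
by apply: eq_bigr => i _; rewrite /= row_seq_col'.
Qed.

Lemma seq_cochain_surj (x0 : X) n (phi : cochain X K n) :
  exists psi, phi = seq_cochain n psi.
Proof.
exists (fun s => phi (\row_i nth x0 s i)).
by apply/funext => v; rewrite /seq_cochain row_seqK.
Qed.

End Deletion.
Arguments seq_cochain {X K} n psi v.

Section Supports.
Context {R : realType} {X : metricType R} (K : pzRingType) (b : X).

Lemma stabilize_ord n (v : 'rV[X]_n.+1) (i : 'I_n.+1) : stabilize v i = v 0 i.
Proof. by rewrite /= /stabilize_fun (minn_idPl _) ?inord_val // -ltnS. Qed.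

Lemma CX_seq_cochain n (psi : seq X -> K) :
  seq_cochain n psi \in @CX R X K n <-> vanishing b n.+1 0 (fun x _ => psi x).
Proof.
split=> [/asboolP bpsi r|Npsi].
  have [M bM] := bpsi (r + 1).
  have supp x y : size x = n.+1 -> all (fun a => mdist y a <= r) x -> psi x != 0 ->
      exists2 v : 'rV[X]_n.+1, mdist y (v 0 0) <= r &
      (support_inf (seq_cochain n psi) `&` nbhd (r + 1) (diagonal_inf X)) (stabilize v).
    move=> xn yx psix; pose v : 'rV[X]_n.+1 := \row_i nth b x i.
    have vx : row_seq v = x by exact: row_of_seqK.
    have /all_row_seq yv : all (fun a => mdist y a <= r) (row_seq v) by rewrite vx.
    exists v; first exact: yv.
    split; first by exists v; rewrite //= /seq_cochain vx.
    exists (stabilize (const_mx y : 'rV_1)); first by exists y.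
    apply: (@le_lt_trans _ _ r); last by rewrite ltrDl.
    by apply: evconst_dist_le => k; rewrite /= /stabilize_fun mxE.
  have [[x0 [y0 [xn0 yx0 psix0]]]|none] := pselect (exists x y,
    [/\ size x = n.+1, all (fun a => mdist y a <= r) x & psi x != 0]); last first.
    exists 0 => x y xn yx _; exists 1 => // s _ _; apply/eqP/negPn/negP => psix.
    by apply: none; exists x, y.
  have [v0 _ Sv0] := supp x0 y0 xn0 yx0 psix0.
  (* A support tuple within [r] of a [y] this far out would be more than [M] away from the support
     tuple [v0]. *)
  exists (mdist b (v0 0 0) + M + r + 1) => x y xn yx yS; exists 1 => // s _ _.
  apply/eqP/negPn/negP => psix; have [v yv Sv] := supp x y xn yx psix.
  have := evconst_dist_ge (stabilize v) (stabilize v0) (ord0 : 'I_n.+1).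
  rewrite !stabilize_ord => /le_trans/(_ (bM _ _ Sv Sv0)) vv0.
  have := metric_triangle b (v0 0 0) y; have := metric_triangle (v0 0 0) (v 0 0) y.
  by rewrite (metric_sym (v 0 0) y) (metric_sym (v0 0 0) (v 0 0)); lra.
apply/asboolP => r; have [S NS] := Npsi r.
have supp t : (support_inf (seq_cochain n psi) `&` nbhd r (diagonal_inf X)) t ->
    forall k, mdist b (t k) <= S + r.
  move=> [[v /= psiv <-] [_ [y _ <-] yv]] k.
  have yvi i : mdist y (v 0 i) < r.
    apply: le_lt_trans yv.
    have := evconst_dist_ge (stabilize (const_mx y : 'rV_1)) (stabilize v) i.
    by rewrite stabilize_ord [stabilize _ _]mxE.
  have byS : mdist b y < S.
    rewrite ltNge; apply/negP => yS.
    have [||e e0 se] := NS (row_seq v) y _ _ yS; first exact: size_row_seq.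
      by apply/all_row_seq => i; exact: ltW.
    by move: psiv; rewrite /seq_cochain (se [::]) ?eqxx.
  have := yvi (inord (minn k n)); rewrite /= /stabilize_fun.
  by have := metric_triangle b y (v 0 (inord (minn k n))); lra.
exists ((S + r) + (S + r)) => s t /supp sb /supp tb.
apply: evconst_dist_le => k; apply: le_trans (metric_triangle _ b _) _.
by apply: lerD; [rewrite metric_sym|].
Qed.

Lemma CB_seq_cochain n (psi : seq X -> K) :
  seq_cochain n psi \in @CB R X K n <-> vanishing b 0 n.+1 (fun _ s => psi s).
Proof.
pose D := diagonal_support (seq_cochain n psi).
pose loc y := exists2 e : R, 0 < e &
  forall s, size s = n.+1 -> all (fun z => mdist y z < e) s -> psi s = 0.
have locP y : loc y <-> ~ D (const_mx y).
  (* A diagonal point lies off the closed support exactly when [psi] vanishes on all tuples in some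
     ball around it. *)
  split=> [[e e0 se] [_ /(_ _ (nbhsx_ballx _ _ e0))[v [/= psiv [_ yv]]]]|nD].
    move/eqP: psiv; apply; apply: se; first exact: size_row_seq.
    by apply/all_row_seq => i; have := yv 0 i; rewrite mxE ballEmdist.
  apply: contrapT => nloc; apply: nD; split; first by exists y.
  move=> U /nbhs_ballP[e /= e0 eU]; apply: contrapT => none; apply: nloc.
  exists e => // s sn ys; apply/eqP/negPn/negP => psis; apply: none.
  pose v : 'rV[X]_n.+1 := \row_i nth b s i.
  have vs : row_seq v = s by exact: row_of_seqK.
  have /all_row_seq yv : all (fun z => mdist y z < e) (row_seq v) by rewrite vs.
  exists v; split; first by rewrite /= /seq_cochain vs.
  by apply: eU; split=> // i j; rewrite (ord1 i) mxE ballEmdist /=.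
split=> [/asboolP[M bM] r|Npsi].
  have [[y0 Dy0]|none] := pselect (exists y, D (const_mx y)); last first.
    by exists 0 => -[|//] y _ _ _; apply/locP => Dy; apply: none; exists y.
  exists (mdist b y0 + M + 1) => -[|//] y _ _ yS; apply/locP => Dy.
  have := le_trans (mdist_mx_le _ _ 0 0) (bM _ _ Dy0 Dy); rewrite !mxE.
  by have := metric_triangle b y0 y; lra.
apply/asboolP; have [S NS] := Npsi 0.
have far y : D (const_mx y) -> mdist b y < S.
  move=> Dy; rewrite ltNge; apply/negP => yS.
  by have /locP/(_ Dy) : loc y by exact: (NS [::] y).
exists (S + S) => _ _ [[y _ <-] cy] [[z _ <-] cz].
have by_ : mdist b y < S by apply: far; split=> //; exists y.
have bz_ : mdist b z < S by apply: far; split=> //; exists z.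
have yz : mdist y z <= S + S.
  by apply: le_trans (metric_triangle _ b _) _; rewrite metric_sym; lra.
apply: mdist_mx_leP => [|i j]; first exact: le_trans (mdist_ge0 y z) yz.
by rewrite !mxE.
Qed.

End Supports.

(** * Isomorphism on cohomology *)

Section Comparison.
Context {R : realType} {X : metricType R} (K : pzRingType).
Hypothesis hX : uniformly_contractible_at_infinity X.

(** Acyclicity of CB/CX on representatives. Applied to cocycles it yields surjectivity, applied to
    primitives injectivity. *)
Lemma CB_mod_CX_coboundary n (chi : cochain X K n) :
  chi \in @CB R X K n -> cochain_diff chi \in @CX R X K n.+1 ->
  exists2 chi', chi' \in @CX R X K n &
    coboundary_of (bounded_complex X K) (chi - chi').
Proof.
have [rho [mu [b [rho_le mu_le contr]]]] := hX.
have [psi ->] := seq_cochain_surj b chi; rewrite cochain_diff_seq.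
case: n chi => [|n] _ /(CB_seq_cochain b) Bpsi /(CX_seq_cochain b) Xdpsi.
  exists (seq_cochain 0 psi); last exact: subrr.
  by apply/(CX_seq_cochain b); exact: CB_CX_degree0.
have [theta [Btheta Xtheta]] := CB_mod_CX_acyclic rho_le mu_le contr Bpsi Xdpsi.
exists (seq_cochain n.+1 (fun s => psi s - bd theta s)).
  exact/(CX_seq_cochain b).
exists (seq_cochain n theta); first exact/(CB_seq_cochain b).
by rewrite cochain_diff_seq; apply/funext => v; exact/esym/subKr.
Qed.

Lemma coboundary_of_cocycle n (chi : cochain X K n) :
  coboundary_of (bounded_complex X K) chi -> cochain_diff chi = 0.
Proof.
by case: n chi => [|n] chi /= => [->|[psi _ <-]]; rewrite ?cochain_diffK ?linear0.
Qed.

Lemma cohomology_class_eq (S : forall n, submodClosed (cochain X K n)) n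
    (y z : cocycle S n) :
  cohomology_class y = cohomology_class z <->
  coboundary_of S (cocycle_val y - cocycle_val z).
Proof.
split=> [/lquot_piP|yz]; first by rewrite unfold_in => /asboolP.
by apply/lquot_piP; rewrite unfold_in; apply/asboolP.
Qed.

Lemma coboundary_incl n (chi : cochain X K n) :
  coboundary_of (coarse_complex X K) chi -> coboundary_of (bounded_complex X K) chi.
Proof.
by case: n chi => [|n] chi //= [psi Xpsi <-]; exists psi => //; exact: CX_sub_CB.
Qed.

(** A primitive [psi] in CB has its differential in CX, so it differs by a cocycle from some [psi']
    in CX, which is again a primitive. *)
Lemma coboundary_reflect n (chi : cochain X K n) : chi \in @CX R X K n ->
  coboundary_of (bounded_complex X K) chi -> coboundary_of (coarse_complex X K) chi.
Proof.
case: n chi => [|n] chi //= Xchi [psi Bpsi dpsi].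
have [|psi' Xpsi' /coboundary_of_cocycle] := CB_mod_CX_coboundary Bpsi.
  by rewrite dpsi.
rewrite linearB /= dpsi => /eqP; rewrite subr_eq0 => /eqP ->.
by exists psi'.
Qed.

Lemma cohomology_class_incl_eq n (y z : cocycle (coarse_complex X K) n) :
  cohomology_class (cocycle_incl y) = cohomology_class (cocycle_incl z) <->
  cohomology_class y = cohomology_class z.
Proof.
split=> /cohomology_class_eq yz; apply/cohomology_class_eq.
  apply: coboundary_reflect yz; apply: rpredB.
    by case/andP: (cocycleP y).
  by case/andP: (cocycleP z).
exact: coboundary_incl.
Qed.

Lemma cohomology_class_incl_surj n (z : cocycle (bounded_complex X K) n) :
  exists y : cocycle (coarse_complex X K) n,
    cohomology_class (cocycle_incl y) = cohomology_class z.
Proof.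
have /andP[Bz /eqP dz] := cocycleP z.
have [|chi Xchi zchi] := CB_mod_CX_coboundary Bz; first by rewrite dz rpred0.
have dchi : cochain_diff chi = 0.
  move: (coboundary_of_cocycle zchi); rewrite linearB /= dz sub0r => /eqP.
  by rewrite oppr_eq0 => /eqP.
have chiP : chi \in @is_cocycle _ _ (coarse_complex X K) n.
  by apply/andP; rewrite dchi.
by exists (Cocycle chiP); apply/esym/cohomology_class_eq.
Qed.

End Comparison.

Theorem theorem4p1 (R : realType) (X : metricType R) (K : pzRingType)
    (hX : uniformly_contractible_at_infinity X) (n : nat) :
  exists f : {linear coarse_cohomology X K n -> bounded_cohomology X K n},
    (forall z : cocycle (coarse_complex X K) n,
       f (cohomology_class z) = cohomology_class (cocycle_incl z)) /\
    bijective f.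
Proof.
have /choice[g gK] : forall a : coarse_cohomology X K n,
    exists z : cocycle (coarse_complex X K) n, a = cohomology_class z.
  exact: lquot_pi_surj.
(* Defined through chosen representatives; independence of the choice and injectivity are the two
   directions of [cohomology_class_incl_eq]. *)
pose f a : bounded_cohomology X K n := cohomology_class (cocycle_incl (g a)).
have f_class z : f (cohomology_class z) = cohomology_class (cocycle_incl z).
  by apply/(cohomology_class_incl_eq hX); rewrite -gK.
have f_linear : linear f.
  move=> a p q; rewrite [p]gK [q]gK !f_class.
  rewrite -[_ + _ in LHS]linearP f_class -linearP; congr cohomology_class.
  exact: val_inj.
pose F : {linear coarse_cohomology X K n -> bounded_cohomology X K n} :=
  HB.pack f (GRing.isLinear.Build K _ _ _ f f_linear).
exists F; split; first exact: f_class.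
have f_surj q : exists p, f p = q.
  have [z ->] := lquot_pi_surj q.
  have [y yz] := cohomology_class_incl_surj hX z.
  by exists (cohomology_class y); rewrite f_class.
have /choice[f' fK] := f_surj.
exists f' => [p|]; last exact: fK.
have := fK (f p); rewrite [f' _]gK [p]gK !f_class.
by move=> /(cohomology_class_incl_eq hX).
Qed.
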